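(* Let $f:[0,1]\to[0,1]$ be a continuous surjection with the small folds property and let $D$ be a dendrite. Then there are continuous surjections $g:[0,1]\to D$ and $h:D\to[0,1]$ such that $h\circ g=f$ and $\operatorname{int}_{[0,1]}(h(U))\neq\emptyset$ for each nonempty open set $U\subset D$.
   Context: A continuum is a compact connected metric space containing at least two points. A dendrite is a locally connected continuum $D$ such that for all $x,y\in D$ there is a unique (possibly degenerate) arc in $D$ with endpoints $x$ and $y$. Let $f:[0,1]\to[0,1]$ be continuous, $a,b\in[0,1]$, and $\delta>0$. We say $f$ is $\delta$-crooked between $a$ and $b$ if for every two points $c,d\in[0,1]$ such that $f(c)=a$ and $f(d)=b$, there is a point $c'$ between $c$ and $d$ and there is a point $d'$ between $c'$ and $d$ such that $|b-f(c')|\le\delta$ and $|a-f(d')|\le\delta$. (Here ''between'' is non-strict and does not presuppose an order: $c'$ lies in the closed interval with endpoints $c$ and $d$, and $d'$ in the closed interval with endpoints $c'$ and $d$.) A continuous $f:[0,1]\to[0,1]$ has the small folds property if for every positive number $\lambda<1$ there exist positive numbers $\beta<\lambda$ and $\xi<\beta/4$ such that for every $a,b\in[0,1]$ with $|a-b|<\beta$, $f$ is $\xi$-crooked between $a$ and $b$. *)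

(* Defs.v *)
From HB Require Import structures.
From mathcomp Require Import all_boot all_order all_algebra.
From mathcomp Require Import all_classical all_reals all_analysis.

Set Implicit Arguments.
Unset Strict Implicit.
Unset Printing Implicit Defensive.

Import Order.TTheory GRing.Theory Num.Theory.
Import numFieldNormedType.Exports.

Local Open Scope classical_set_scope.
Local Open Scope ring_scope.

Definition unit_interval (R : realType) : set R := `[0, 1]%classic.
Arguments unit_interval R : clear implicits.

Definition is_continuum (R : realType) (T : metricType R) : Prop :=
  [/\ compact [set: T], connected [set: T] & exists x y : T, x <> y].

Definition locally_connected (T : topologicalType) : Prop :=
  forall (x : T) (U : set T), open U -> U x ->
    exists V : set T, [/\ open V, connected V, V x & V `<=` U].

(* [phi] restricts to a homeomorphism from [A] onto [B], with inverse [psi];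
   the values of [phi] off [A] and of [psi] off [B] are irrelevant. *)
Definition is_homeomorphism (T U : topologicalType) (A : set T) (B : set U)
    (phi : T -> U) (psi : U -> T) : Prop :=
  [/\ {within A, continuous phi}, {within B, continuous psi},
      set_fun A B phi, set_fun B A psi
    & (forall x, A x -> psi (phi x) = x) /\ (forall y, B y -> phi (psi y) = y)].

(* The first disjunct is the degenerate arc. *)
Definition is_arc_between (R : realType) (T : topologicalType) (x y : T)
    (A : set T) : Prop :=
  (x = y /\ A = [set x]) \/
  exists (phi : R -> T) (psi : T -> R),
    [/\ is_homeomorphism (unit_interval R) A phi psi, phi 0 = x & phi 1 = y].

Definition is_dendrite (R : realType) (D : metricType R) : Prop :=
  [/\ is_continuum D, locally_connected D
    & forall x y : D, exists! A : set D, is_arc_between R x y A].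

(* [z] lies in the closed interval with endpoints [x] and [y], in any order. *)
Definition between (R : realType) (x y z : R) : Prop :=
  Num.min x y <= z <= Num.max x y.

Definition crooked (R : realType) (f : R -> R) (delta a b : R) : Prop :=
  forall c d : R, unit_interval R c -> unit_interval R d ->
    f c = a -> f d = b ->
    exists c' d' : R, [/\ between c d c', between c' d d',
      `|b - f c'| <= delta & `|a - f d'| <= delta].

Definition small_folds (R : realType) (f : R -> R) : Prop :=
  forall lambda : R, 0 < lambda < 1 ->
    exists beta xi : R, [/\ 0 < beta < lambda, 0 < xi < beta / 4
      & forall a b : R, unit_interval R a -> unit_interval R b ->
          `|a - b| < beta -> crooked f xi a b].

(* The interior of [B] relative to [A]; the intersection discards the points
   off [A], which are isolated in the library's [subspace A]. *)
Definition rel_interior (T : topologicalType) (A B : set T) : set T :=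
  A `&` @interior (subspace A) B.

(* Main.v *)
Require Import Defs.
From mathcomp Require Import all_boot all_order all_algebra.
From mathcomp Require Import all_classical all_reals all_analysis.
From mathcomp Require Import lra.

(** The dendrite is exhausted by trees T_0, T_1, ..., each obtained from the
    previous one by attaching an arc, and the two maps are uniform limits of maps
    g_n from [0, 1] onto T_n and h_n from D to [0, 1] with h_n o g_n = f. The
    first tree is an arc, h_0 a parameter on it, and g_0 is f read in that
    parameter.

    Small folds serve to attach a branch [x, e] to T_n at a point x of T_n
    ([grow]). Put p = h_n x, and suppose that g_n passes through x on a time
    interval on which f goes from below p to above p and on which f u determines
    g_n u (a [crossing]). Crookedness between two levels just around p makes f
    fold inside this interval ([excursion]): f rises from p to some M > p, comes
    back to p, drops below p, and then climbs above M. During the first excursion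
    g_{n+1} is diverted into the branch, which h_{n+1} maps onto [p, M]. Nothing
    of T_n is lost, since the final climb passes through every point that was
    visited during the excursion. Moreover h_{n+1} agrees with h_n on T_n, and
    the two differ by at most M - p elsewhere, which is as small as desired.

    The construction can go on because every point of T_{n+1} which is not an
    endpoint of D has a crossing again. Hence all branches should end at endpoints
    of D, for then they are always attached at points which are not endpoints
    ([branch_point_interior]). There are enough endpoints: a maximality argument
    extends every arc from a given point to one which ends at an endpoint
    ([endpoint_exists]). Crossings also give the last assertion, as a crossing
    that g_n performs inside an open set U provides an interval of values of h
    on U.

    For the convergence, g_{n+1} may be far from g_n, but composed with the
    retraction of D onto any tree contained in T_n the two are 2^-n close, and
    the retractions onto the T_n converge uniformly to the identity. Both facts
    rest on the property that arcs between close points are small ([arc_small]).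
    This is where local connectedness enters, in two classical steps: close
    points are joined by small paths ([locally_path_connected]), and every path
    contains an arc with the same endpoints ([path_contains_arc]). By uniqueness
    of arcs, the arc between two points is then the set of points that every path
    between them must visit. With [arc] defined as this set, the elementary
    geometry of dendrites becomes a short calculus of inclusions. *)

Set Implicit Arguments.
Unset Strict Implicit.
Unset Printing Implicit Defensive.

Import Order.TTheory GRing.Theory Num.Theory.
Import numFieldNormedType.Exports.
Local Open Scope classical_set_scope.
Local Open Scope ring_scope.

(** * Metric continuity, levels and uniform limits *)

Section eps_delta.
Context {R : realType}.

Lemma cvg_distP {T} {F : set_system T} {FF : Filter F} (D : metricType R) (f : T -> D) (y : D) :
  f @ F --> y <-> forall e, 0 < e -> \forall t \near F, mdist y (f t) < e.
Proof. exact: metricType_numDomainType.cvgrPdist_lt. Qed.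

Lemma nbhs_distP (D : metricType R) (x : D) (P : set D) :
  nbhs x P <-> exists2 r, 0 < r & forall y, mdist x y < r -> P y.
Proof.
rewrite -nbhs_ballE; split=> [[r r0 rP]|[r r0 rP]]; exists r => //.
  by move=> y xy; apply: rP; rewrite ballEmdist.
by move=> y; rewrite ballEmdist; exact: rP.
Qed.

Lemma cont_pathP (D : metricType R) (g : R -> D) :
  continuous g <-> forall u e, 0 < e ->
    exists2 r, 0 < r & forall v, `|v - u| < r -> mdist (g u) (g v) < e.
Proof.
split=> [gc u e e0|H u].
  have /cvg_distP/(_ e e0) := gc u.
  move=> /nbhs_ballP[r r0 rP]; exists r => // v vu.
  by apply: rP; rewrite /ball/= distrC.
apply/cvg_distP => e e0; have [r r0 rP] := H u e e0.
by apply/nbhs_ballP; exists r => // v; rewrite /ball/= distrC; exact: rP.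
Qed.

Lemma cont_funP (D : metricType R) (h : D -> R) :
  continuous h <-> forall x e, 0 < e ->
    exists2 r, 0 < r & forall y, mdist x y < r -> `|h y - h x| < e.
Proof.
split=> [hc x e e0|H x].
  have /(@cvgrPdist_lt _ R^o) /(_ e e0) := hc x.
  by move=> /nbhs_distP[r r0 rP]; exists r => // y /rP; rewrite distrC.
apply/(@cvgrPdist_lt _ R^o) => e e0; have [r r0 rP] := H x e e0.
by apply/nbhs_distP; exists r => // y /rP; rewrite distrC.
Qed.

Lemma cont_realP (h : R -> R) :
  continuous h <-> forall x e, 0 < e ->
    exists2 r, 0 < r & forall y, `|y - x| < r -> `|h y - h x| < e.
Proof. exact: (@cont_pathP R^o h). Qed.

Lemma cont_selfP (D : metricType R) (h : D -> D) :
  continuous h <-> forall x e, 0 < e ->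
    exists2 r, 0 < r & forall y, mdist x y < r -> mdist (h x) (h y) < e.
Proof.
split=> [hc x e e0|H x].
  by have /cvg_distP/(_ e e0) := hc x; move=> /nbhs_distP.
by apply/cvg_distP => e e0; apply/nbhs_distP; exact: H.
Qed.

Lemma mdist_contraction (D : metricType R) (x y z : D) :
  `|mdist x y - mdist x z| <= mdist y z.
Proof.
have := metric_triangle x y z; have := metric_triangle x z y.
by rewrite (metric_sym z y) ler_norml; lra.
Qed.

Lemma metric_eq0P (D : metricType R) (x y : D) :
  (forall e, 0 < e -> mdist x y < e) -> x = y.
Proof.
move=> xy; apply: mdist_positivity; apply/eqP; rewrite eq_le mdist_ge0 andbT.
by rewrite leNgt; apply/negP => /xy; rewrite ltxx.
Qed.

End eps_delta.

Section real_line.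
Context {R : realType}.

Lemma first_hit (C : set R) (c d : R) : closed C -> c <= d -> C d ->
  exists m, [/\ c <= m <= d, C m & forall u, c <= u < m -> ~ C u].
Proof.
move=> cC cd Cd.
have cK : compact (`[c, d] `&` C) by apply: compact_closedI => //; exact: segment_compact.
have K0 : (`[c, d]%classic `&` C) !=set0.
  by exists d; split => //=; rewrite in_itv/= cd lexx.
have idc : {within `[c, d] `&` C, continuous (fun x : R => x)}.
  by apply: continuous_subspaceT => x.
have [m + mmin] := compact_EVT_min K0 cK idc.
rewrite inE /= in_itv/= => -[cmd Cm].
exists m; split => // u /andP[cu um] Cu.
have : u \in `[c, d]%classic `&` C.
  rewrite inE /= in_itv/= cu; split => //.
  by case/andP: cmd => _; exact/le_trans/ltW.
by move/mmin; rewrite leNgt um.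
Qed.

Lemma last_hit (C : set R) (c d : R) : closed C -> c <= d -> C c ->
  exists m, [/\ c <= m <= d, C m & forall u, m < u <= d -> ~ C u].
Proof.
move=> cC cd Cc.
have cK : compact (`[c, d] `&` C) by apply: compact_closedI => //; exact: segment_compact.
have K0 : (`[c, d]%classic `&` C) !=set0.
  by exists c; split => //=; rewrite in_itv/= cd lexx.
have idc : {within `[c, d] `&` C, continuous (fun x : R => x)}.
  by apply: continuous_subspaceT => x.
have [m + mmax] := compact_EVT_max K0 cK idc.
rewrite inE /= in_itv/= => -[cmd Cm].
exists m; split => // u /andP[mu ud] Cu.
have : u \in `[c, d]%classic `&` C.
  rewrite inE /= in_itv/= ud andbT; split => //.
  by case/andP: cmd => + _; move=> /le_trans; apply; exact: ltW.
by move/mmax; rewrite leNgt mu.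
Qed.

Lemma closed_level (f : R -> R) (p : R) : continuous f -> closed [set u | f u = p].
Proof.
move=> fc.
rewrite (_ : [set u | f u = p] = f @^-1` [set x | x = p]) //.
by apply: closed_comp => [x _|]; [exact: fc|exact: closed_eq].
Qed.

Lemma ivt (f : R -> R) (a b v : R) : continuous f -> a <= b ->
  f a <= v -> v <= f b -> exists2 u, a <= u <= b & f u = v.
Proof.
move=> fc ab av vb; have [||u] := @IVT R f a b v ab.
- exact: continuous_subspaceT.
- by rewrite ge_min av le_max vb orbT.
- by rewrite in_itv/= => uab <-; exists u.
Qed.

Lemma dist_maxl (a x y : R) : `|Num.max a x - Num.max a y| <= `|x - y|.
Proof.
have n1 := ler_norm (x - y); have := ler_norm (y - x); rewrite (distrC y x) => n2.
rewrite ler_norml; move: n1 n2 (normr_ge0 (x - y)); set n := `|_| => n1 n2 n0.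
by case: (leP a x) => ax; case: (leP a y) => ay; apply/andP; split; lra.
Qed.

Lemma dist_minl (a x y : R) : `|Num.min a x - Num.min a y| <= `|x - y|.
Proof.
have n1 := ler_norm (x - y); have := ler_norm (y - x); rewrite (distrC y x) => n2.
rewrite ler_norml; move: n1 n2 (normr_ge0 (x - y)); set n := `|_| => n1 n2 n0.
by case: (leP a x) => ax; case: (leP a y) => ay; apply/andP; split; lra.
Qed.

(** Used for compact metric spaces and for the real line alike. *)
Definition seq_complete (Y : metricType R) := forall u : nat -> Y,
  (forall e, 0 < e -> exists N, forall m n, (N <= m)%N -> (N <= n)%N ->
     mdist (u m) (u n) < e) ->
  exists l, forall e, 0 < e -> exists N, forall n, (N <= n)%N ->
     mdist (u n) l < e.

Lemma compact_seq_complete (D : metricType R) :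
  compact [set: D] -> seq_complete D.
Proof.
move=> cD u cu.
have [l [_ ul]] := cD (u n @[n --> \oo]) _ filterT.
exists l => e e0; have [N NP] := cu (e / 2) (divr_gt0 e0 (ltr0Sn _ _)).
exists N => n Nn.
have [] := ul [set x | exists2 m, (N <= m)%N & x = u m] (ball l (e / 2)).
- by exists N => // m /= Nm; exists m.
- by apply: nbhsx_ballx; rewrite divr_gt0.
- move=> _ [[m Nm ->]]; rewrite ballEmdist/= => lm.
  have := NP _ _ Nm Nn; have := metric_triangle (u n) (u m) l.
  rewrite (metric_sym (u n) (u m)) (metric_sym (u m) l); lra.
Qed.

Lemma real_seq_complete : seq_complete (R^o : metricType R).
Proof.
move=> u cu.
have : cvg (u n @[n --> \oo]).
  apply: cauchy_cvg; apply/cauchy_ballP => e e0.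
  have [N NP] := cu e e0.
  exists ([set x | exists2 m, (N <= m)%N & x = u m],
          [set x | exists2 m, (N <= m)%N & x = u m]) => /=.
    by split; exists N => // m /= Nm; exists m.
  move=> [x y] /= [[m Nm ->] [n Nn ->]].
  by have := NP _ _ Nn Nm; rewrite /ball/=.
move=> /(@cvgrPdist_lt _ R^o) ul; exists (lim (u n @[n --> \oo])) => e e0.
have [N _ NP] := ul e e0.
by exists N => n Nn; have := NP n Nn.
Qed.

Lemma uniform_limit (X : Type) (Y : metricType R) (F : nat -> X -> Y) :
  seq_complete Y ->
  (forall e, 0 < e -> exists N, forall m n x, (N <= m)%N -> (N <= n)%N ->
     mdist (F m x) (F n x) < e) ->
  exists G, forall e, 0 < e -> exists N, forall n x, (N <= n)%N ->
     mdist (F n x) (G x) < e.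
Proof.
move=> cY cF.
have /choice[G GP] : forall x, exists l, forall e, 0 < e -> exists N, forall n, (N <= n)%N ->
     mdist (F n x) l < e.
  move=> x; apply: cY => e /cF[N NP]; exists N => m n ? ?; exact: NP.
exists G => e e0; have [N NP] := cF (e / 2) (divr_gt0 e0 (ltr0Sn _ _)).
exists N => n x Nn; have [M MP] := GP x (e / 2) (divr_gt0 e0 (ltr0Sn _ _)).
have := NP n (maxn N M) x Nn (leq_maxl _ _).
have := MP (maxn N M) (leq_maxr _ _).
have := metric_triangle (F n x) (F (maxn N M) x) (G x); lra.
Qed.

Lemma uniform_limit_cont (X : topologicalType) (Y : metricType R) (F : nat -> X -> Y) (G : X -> Y) :
  (forall n, continuous (F n)) ->
  (forall e, 0 < e -> exists N, forall n x, (N <= n)%N -> mdist (F n x) (G x) < e) ->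
  continuous G.
Proof.
move=> Fc FG x; apply/cvg_distP => e e0.
have e3 : 0 < e / 3 by rewrite divr_gt0.
have [N NP] := FG _ e3.
have /cvg_distP/(_ _ e3) := Fc N x; apply: filterS => y.
have := NP N x (leqnn _); have := NP N y (leqnn _).
have := metric_triangle (G x) (F N x) (G y); have := metric_triangle (F N x) (F N y) (G y).
rewrite (metric_sym (G x) (F N x)); lra.
Qed.

Lemma geom_small (e : R) : 0 < e -> exists N, forall n, (N <= n)%N -> (2^-1 : R) ^+ n < e.
Proof.
move=> e0.
have /(@cvgrPdist_lt _ R^o)/(_ e e0)[N _ NP] : (2^-1 : R) ^+ n @[n --> \oo] --> (0 : R).
  by apply: cvg_expr; rewrite ger0_norm ?invr_ge0// invf_lt1// ltr1n.
exists N => n /NP /=; by rewrite sub0r normrN ger0_norm //.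
Qed.

Lemma geom_cauchy (X : Type) (Y : metricType R) (F : nat -> X -> Y) (C : R) :
  (forall n x, mdist (F n x) (F n.+1 x) <= C * 2^-1 ^+ n) ->
  forall n m x, (n <= m)%N -> mdist (F n x) (F m x) <= 2 * C * 2^-1 ^+ n.
Proof.
move=> FC n m x nm.
have C0 : 0 <= C by have := FC 0%N x; have := mdist_ge0 (F 0%N x) (F 1%N x); rewrite expr0 mulr1; lra.
suff : mdist (F n x) (F m x) <= 2 * C * (2^-1 ^+ n - 2^-1 ^+ m).
  move/le_trans; apply; rewrite ler_wpM2l ?mulr_ge0// gerDl oppr_le0.
  by rewrite exprn_ge0// invr_ge0.
rewrite -(subnKC nm); elim: (m - n)%N => [|k IH].
  by rewrite addn0 subrr mulr0 mdistxx.
rewrite addnS; have := FC (n + k)%N x; have := metric_triangle (F n x) (F (n + k)%N x) (F (n + k).+1 x).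
rewrite exprS; move: IH; lra.
Qed.

Lemma dep_choice (S : Type) (P : nat -> S -> Prop) (Q : nat -> S -> S -> Prop) (s0 : S) :
  P 0%N s0 -> (forall n s, P n s -> exists2 s', P n.+1 s' & Q n s s') ->
  exists u : nat -> S, u 0%N = s0 /\ forall n, P n (u n) /\ Q n (u n) (u n.+1).
Proof.
move=> P0 PQ.
have /choice[F FP] : forall p : nat * S, exists s', P p.1 p.2 -> P p.1.+1 s' /\ Q p.1 p.2 s'.
  move=> [n s] /=; have [/PQ[s' ? ?]|nP] := pselect (P n s); first by exists s'.
  by exists s.
pose u := fix u n := if n is m.+1 then F (m, u m) else s0.
have uP n : P n (u n) by elim: n => [//|n IH]; case: (FP (n, u n) IH).
by exists u; split => // n; split => //; case: (FP (n, u n) (uP n)).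
Qed.

End real_line.

(** * Local path connectedness *)

Section local_paths.
Context {R : realType} (D : metricType R).
Hypothesis D_compact : compact [set: D].
Hypothesis D_lc : locally_connected D.

Lemma lebesgue_number (P : R -> D -> Prop) :
  (forall r r' y, r' <= r -> P r y -> P r' y) ->
  (forall x, exists2 r, 0 < r & forall y, mdist x y < r -> P r y) ->
  exists2 r, 0 < r & forall y, P r y.
Proof.
move=> Pmono Ploc.
have := D_compact; rewrite compact_near_coveringP => /(_ R (0 : R)^'+ P _).
have cov : forall x, [set: D] x -> \forall x' \near x & i \near 0^'+, P i x'.
  move=> x _; have [r r0 rP] := Ploc x.
  exists ([set y | mdist x y < r], [set s | s < r]).
    split; first by apply/nbhs_distP; exists r.
    exact: nbhs_right_lt.
  by move=> [y s] /= [yr sr]; apply: (Pmono r); [exact: ltW|exact: rP].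
move=> /(_ cov) nP.
have [r [r0 rP]] : exists r, 0 < r /\ [set: D] `<=` P r.
  have : \forall i \near (0:R)^'+, 0 < i /\ [set: D] `<=` P i.
    by near=> i; split; near: i => //; exact: nbhs_right_gt.
  by move=> /filter_ex.
by exists r => // y; exact: rP.
Unshelve. all: by end_near. Qed.

(** By compactness, the connected neighbourhoods given by local connectedness at
    the points of D can be chosen with a common size. *)
Lemma uniformly_locally_connected (e : R) : 0 < e ->
  exists2 r, 0 < r & forall y z : D, mdist y z < r ->
    exists C, [/\ connected C, C y, C z & forall w, C w -> mdist y w < e].
Proof.
move=> e0.
pose P (r : R) (y : D) := forall z : D, mdist y z < r ->
    exists C, [/\ connected C, C y, C z & forall w, C w -> mdist y w < e].
suff [r r0 rP] : exists2 r, 0 < r & forall y, P r y by exists r.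
apply: lebesgue_number.
  by move=> r r' y rr' Pr z yz; apply: Pr; exact: lt_le_trans yz _.
move=> x.
have e20 : 0 < e / 2 by rewrite divr_gt0.
have [] := D_lc (U := interior (ball x (e / 2))) (x := x).
- exact: open_interior.
- exact: nbhsx_ballx.
move=> V [oV cV Vx VU].
have : nbhs x V by exact: open_nbhs_nbhs.
move=> /nbhs_distP[r r0 rV]; exists (r / 2); first by rewrite divr_gt0.
move=> y xy z yz; exists V.
have Vy : V y by apply: rV; lra.
split => //.
- by apply: rV; have := metric_triangle x y z; lra.
- move=> w Vw.
  have := interior_subset (VU _ Vw); rewrite ballEmdist /=.
  have := interior_subset (VU _ Vy); rewrite ballEmdist /=.
  by have := metric_triangle y x w; rewrite (metric_sym y x); lra.
Qed.

(** The points reachable from y by steps shorter than e form a subset of C which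
    is both open and closed in C. *)
Lemma connected_chain (C : set D) (y z : D) (e : R) :
  connected C -> C y -> C z -> 0 < e ->
  exists n (c : nat -> D), [/\ c 0%N = y, forall i, (n <= i)%N -> c i = z,
    forall i, mdist (c i) (c i.+1) < e & forall i, C (c i)].
Proof.
move=> cC Cy Cz e0.
pose B := [set w | exists n (c : nat -> D), [/\ c 0%N = y, forall i, (n <= i)%N -> c i = w,
    forall i, mdist (c i) (c i.+1) < e & forall i, C (c i)]].
have By : B y.
  by exists 0%N, (fun=> y); split => // i; rewrite mdistxx.
have BC : B `<=` C by move=> w [n [c [_ cn _ cC']]]; rewrite -(cn n).
have Bstep w v : B w -> C v -> mdist w v < e -> B v.
  move=> [n [c [c0 cn cs cC']]] Cv wv.
  exists n.+1, (fun i => if (i <= n)%N then c i else v); split => //.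
  - by move=> i; rewrite ltnNge => /negbTE ->.
  - move=> i; case: (ltngtP i n) => [//|//|->].
      by rewrite mdistxx.
    by rewrite cn.
  - by move=> i; case: ifP.
suff : B z by [].
suff CB : B = C by rewrite CB.
apply: cC; first by exists y.
- exists (\bigcup_(w in B) interior (ball w e)).
    by apply: bigcup_open => w _; exact: open_interior.
  apply/seteqP; split => [w Bw|w [Cw [v Bv vw]]].
    split; first exact: BC.
    by exists w => //; exact: nbhsx_ballx.
  by apply: (Bstep v) => //; move/interior_subset : vw; rewrite ballEmdist.
- exists (closure B); first exact: closed_closure.
  apply/seteqP; split => [w Bw|w [Cw Bw]].
    by split; [exact: BC|exact: subset_closure].
  have [v [Bv]] := Bw _ (nbhsx_ballx w e e0).
  rewrite ballEmdist /= => wv.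
  by apply: (Bstep v) => //; rewrite metric_sym.
Qed.


(** Each link of a chain is replaced by a chain with steps shorter than s. All
    links receive the same number N of steps, by waiting at the end of the link,
    so that the refined chain follows the old one at the index m %/ N. *)
Lemma refine_chain (r e s : R) (c : nat -> D) (L : nat) :
  (forall y z : D, mdist y z < r ->
    exists C, [/\ connected C, C y, C z & forall w, C w -> mdist y w < e]) ->
  0 < e -> 0 < s ->
  (forall i, mdist (c i) (c i.+1) < r) -> (forall i, (L <= i)%N -> c i = c L) ->
  exists N (c' : nat -> D), [/\ (0 < N)%N, c' 0%N = c 0%N,
    forall i, (L * N <= i)%N -> c' i = c L,
    forall i, mdist (c' i) (c' i.+1) < s
    & forall m, mdist (c (m %/ N)%N) (c' m) < e].
Proof.
move=> He e0 s0 cr cL.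
have /choice[k kP] : forall i, exists p : nat * (nat -> D),
    [/\ p.2 0%N = c i, forall j, (p.1 <= j)%N -> p.2 j = c i.+1,
      forall j, mdist (p.2 j) (p.2 j.+1) < s & forall j, mdist (c i) (p.2 j) < e].
  move=> i; have [C [cC Cy Cz Ce]] := He _ _ (cr i).
  have [n [d [d0 dn ds dC]]] := connected_chain cC Cy Cz s0.
  by exists (n, d); split => // j; apply: Ce.
pose N := (\max_(i < L) (k i).1).+1.
have kN i : (i < L)%N -> ((k i).1 <= N)%N.
  move=> iL; rewrite /N; apply: leqW.
  exact: (@leq_bigmax _ (fun i : 'I_L => (k i).1) (Ordinal iL)).
pose q i j := if (i < L)%N then (k i).2 j else c i.
have q0 i : q i 0%N = c i by rewrite /q; case: ifP => // _; case: (kP i).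
have qs i j : mdist (q i j) (q i j.+1) < s.
  by rewrite /q; case: ifP => _; [case: (kP i)|rewrite mdistxx].
have qe i j : mdist (c i) (q i j) < e.
  by rewrite /q; case: ifP => _; [case: (kP i)|rewrite mdistxx].
have qN i : q i N = c i.+1.
  rewrite /q; case: ifPn => [iL|]; first by case: (kP i) => _ + _ _; apply; exact: kN.
  rewrite -leqNgt => Li; rewrite cL // [RHS]cL //; exact: leq_trans Li _.
exists N, (fun m => q (m %/ N)%N (m %% N)%N); split => //.
- move=> i Li; have Ld : (L <= i %/ N)%N by rewrite leq_divRL.
  by rewrite /q ltnNge Ld /= cL.
- move=> i; have [iN|] := ltnP (i %% N).+1 N.
    have -> : (i.+1 %/ N = i %/ N)%N.
      by rewrite {1}(divn_eq i N) -addnS divnMDl // (divn_small iN) addn0.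
    have -> // : (i.+1 %% N = (i %% N).+1)%N.
      by rewrite {1}(divn_eq i N) -addnS modnMDl modn_small.
  move=> iN; have {}iN : (i %% N).+1 = N by apply/eqP; rewrite eqn_leq iN andbT ltn_mod.
  have -> : (i.+1 %/ N = (i %/ N).+1)%N.
    by rewrite {1}(divn_eq i N) -addnS iN -mulSnr mulnK.
  have -> : (i.+1 %% N = 0)%N.
    by rewrite {1}(divn_eq i N) -addnS iN -mulSnr modnMl.
  by rewrite q0 -qN; move: (qs (i %/ N)%N (i %% N)%N); rewrite iN.
Qed.

Lemma truncn_divn (t : R) (L N : nat) : (0 < N)%N ->
  (Num.truncn (t * (L * N)%:R) %/ N = Num.truncn (t * L%:R))%N.
Proof.
move=> N0; have [t0|t0] := leP 0 t; last first.
  have neg (M : nat) : Num.truncn (t * M%:R) = 0%N.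
    by apply/truncn0Pn; rewrite -ltNge; apply: le_lt_trans ltr01; rewrite nmulr_rle0.
  by rewrite !neg; exact: div0n.
have tL : 0 <= t * L%:R by rewrite mulr_ge0.
have tLN : 0 <= t * (L * N)%:R by rewrite mulr_ge0.
apply/esym/truncn_def.
have NR : (0 : R) < N%:R by rewrite ltr0n.
have /andP[h1 h2] := truncn_itv tLN.
set m := Num.truncn _ in h1 h2 *.
move: h1 h2; rewrite natrM mulrA => h1 h2; apply/andP; split.
  rewrite -(ler_pM2r NR); apply: le_trans h1.
  by rewrite -natrM ler_nat leq_trunc_div.
rewrite -(ltr_pM2r NR); apply: lt_le_trans h2 _.
by rewrite -natrM ler_nat ltn_ceil.
Qed.

Lemma truncn_near (t s : R) (L : nat) : 0 <= s - t -> (s - t) * L%:R < 1 ->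
  Num.truncn (s * L%:R) = Num.truncn (t * L%:R) \/
  Num.truncn (s * L%:R) = (Num.truncn (t * L%:R)).+1.
Proof.
rewrite mulrBl subr_ge0 => ts st.
have le1 : (Num.truncn (s * L%:R) <= (Num.truncn (t * L%:R)).+1)%N.
  rewrite truncn_le_nat; have := truncnS_gt (t * L%:R).
  rewrite -addn1 natrD -[in X in _ -> X]addn1 -[in X in _ -> X]addn1 !natrD; lra.
have le2 : (Num.truncn (t * L%:R) <= Num.truncn (s * L%:R))%N.
  rewrite truncn_le_nat; apply: le_lt_trans (truncnS_gt (s * L%:R)).
  by rewrite ler_wpM2r.
by move: le2; rewrite leq_eqVlt => /orP[/eqP->|lt2]; [left|right; apply/eqP; rewrite eqn_leq le1].
Qed.

(** The step functions given by successive refinements of a chain from y to z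
    converge uniformly, since the k-th refinement moves points by less than ep k;
    the limit is continuous because their jumps tend to 0. *)
Lemma locally_path_connected (e : R) : 0 < e ->
  exists2 r, 0 < r & forall y z : D, mdist y z < r ->
    exists g : R -> D, [/\ continuous g, g 0 = y, g 1 = z & forall t, mdist y (g t) < e].
Proof.
move=> e0; pose ep k : R := e / 8 * 2^-1 ^+ k.
have ep0 k : 0 < ep k by rewrite /ep mulr_gt0 ?divr_gt0 // exprn_gt0 // invr_gt0.
have /choice[dl dlP] : forall k, exists r, [/\ 0 < r, r <= ep k & forall y z : D, mdist y z < r ->
    exists C, [/\ connected C, C y, C z & forall w, C w -> mdist y w < ep k]].
  move=> k; have [r r0 rP] := uniformly_locally_connected (ep0 k).
  exists (Num.min r (ep k)); split.
  - by rewrite lt_min r0 ep0.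
  - by rewrite ge_min lexx orbT.
  - by move=> y z yz; apply: rP; apply: lt_le_trans yz _; rewrite ge_min lexx.
exists (dl 0%N) => [|y z yz]; first by case: (dlP 0%N).
pose P k (s : nat * (nat -> D)) := [/\ (0 < s.1)%N, s.2 0%N = y,
  forall i, (s.1 <= i)%N -> s.2 i = z & forall i, mdist (s.2 i) (s.2 i.+1) < dl k].
pose Q k (s s' : nat * (nat -> D)) :=
  forall t : R, mdist (s.2 (Num.truncn (t * s.1%:R))) (s'.2 (Num.truncn (t * s'.1%:R))) < ep k.
have P0 : P 0%N (1%N, fun i => if i is 0%N then y else z).
  split => //=; first by case.
  by case=> [//|i]; rewrite mdistxx; case: (dlP 0%N).
have PQ k s : P k s -> exists2 s', P k.+1 s' & Q k s s'.
  case: s => L c [/= L0 c0 cL cd]; have [_ _ dk] := dlP k.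
  have [dk1 _ _] := dlP k.+1.
  have cL' i : (L <= i)%N -> c i = c L by move=> Li; rewrite !cL.
  have [N [c' [N0 c'0 c'L c's c'e]]] := refine_chain dk (ep0 k) dk1 cd cL'.
  exists ((L * N)%N, c').
    split => //=; [by rewrite muln_gt0 L0|by rewrite c'0|].
    by move=> i /c'L ->; rewrite cL.
  by move=> t /=; rewrite -(@truncn_divn t L N).
have [u [u0 uPQ]] := dep_choice P0 PQ.
pose G k (t : R) := (u k).2 (Num.truncn (t * (u k).1%:R)).
have GG k t : mdist (G k t) (G k.+1 t) <= e / 8 * 2^-1 ^+ k.
  by case: (uPQ k) => _ /(_ t) /ltW.
have Gc := geom_cauchy GG.
have [g gP] : exists g, forall e, 0 < e -> exists N, forall n x, (N <= n)%N ->
     mdist (G n x) (g x) < e.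
  apply: uniform_limit; first exact: compact_seq_complete.
  move=> d d0.
  have [N NP] := geom_small (divr_gt0 d0 e0).
  have step n t : (N <= n)%N -> mdist (G N t) (G n t) <= d / 4.
    move=> Nn; apply: le_trans (Gc _ _ t Nn) _.
    have := NP N (leqnn _); rewrite ltr_pdivlMr //; set q := _ ^+ N => h; lra.
  exists N => m n t Nm Nn; have := step m t Nm; have := step n t Nn.
  by have := metric_triangle (G m t) (G N t) (G n t); rewrite (metric_sym (G m t) (G N t)); lra.
have G0 k : G k 0 = y.
  by rewrite /G mul0r truncn0; case: (uPQ k) => -[].
have G1 k : G k 1 = z.
  by rewrite /G mul1r natrK; case: (uPQ k) => -[_ _ + _] _; apply.
have lim_const t w : (forall k, G k t = w) -> g t = w.
  move=> Gw; apply/esym/mdist_positivity/eqP; rewrite eq_le mdist_ge0 andbT.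
  rewrite leNgt; apply/negP => /gP[N /(_ N t (leqnn _))].
  by rewrite Gw ltxx.
exists g; split; [|exact: lim_const|exact: lim_const|].
  apply/cont_pathP => t d d0.
  have d4 : 0 < d / 4 by rewrite divr_gt0.
  have [N NP] := gP _ d4.
  have [M MP] := geom_small (divr_gt0 d0 e0).
  pose k := maxn N M.
  have Nk := NP k _ (leq_maxl _ _); have := MP k (leq_maxr _ _).
  rewrite ltr_pdivlMr //; set q := _ ^+ k => Mk.
  case: (uPQ k) => -[L0 _ _ cd] _.
  have L0R : (0 : R) < (u k).1%:R by rewrite ltr0n.
  have [_ dlk _] := dlP k.
  exists ((u k).1%:R^-1); first by rewrite invr_gt0.
  have Gnear s1 s2 : 0 <= s1 - s2 -> (s1 - s2) < (u k).1%:R^-1 -> mdist (G k s2) (G k s1) < d / 4.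
    move=> s12; rewrite -div1r ltr_pdivlMr // => s12'; rewrite /G.
    case: (truncn_near s12 s12') => ->; first by rewrite mdistxx.
    by apply: lt_trans (cd _) _; apply: le_lt_trans dlk _; rewrite /ep -/q; lra.
  move=> s st.
  have Gst : mdist (G k t) (G k s) < d / 4.
    have [ts|ts] := leP t s.
      by apply: Gnear; [rewrite subr_ge0|move: st; rewrite ger0_norm // subr_ge0].
    rewrite metric_sym; apply: Gnear; first by rewrite subr_ge0 ltW.
    by move: st; rewrite distrC ger0_norm // subr_ge0 ltW.
  have := Nk t; have := Nk s.
  have := metric_triangle (g t) (G k t) (g s); have := metric_triangle (G k t) (G k s) (g s).
  by rewrite (metric_sym (g t) (G k t)); lra.
move=> t.
have e4 : 0 < e / 4 by rewrite divr_gt0.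
have [N NP] := gP _ e4; have := NP N t (leqnn _).
have := Gc 0%N N t (leq0n _).
have dyz : mdist y (G 0%N t) < e / 8.
  have [_ + _] := dlP 0%N; rewrite /ep expr0 mulr1 => d0.
  rewrite /G u0 /=; case: (Num.truncn _) => [|_]; first by rewrite mdistxx divr_gt0.
  exact: lt_le_trans yz _.
have := metric_triangle y (G 0%N t) (g t); have := metric_triangle (G 0%N t) (G N t) (g t).
by rewrite expr0; lra.
Qed.

End local_paths.

(** * Every path contains an arc *)

Section arcs_in_paths.
Context {R : realType}.

Lemma unit_intervalP (u : R) : unit_interval R u <-> 0 <= u <= 1.
Proof. by rewrite /unit_interval /= in_itv. Qed.

(** Precomposition with this retraction of the line onto [0, 1] turns maps that
    are continuous on [0, 1] into maps continuous on the line. *)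
Definition clamp (u : R) : R := Num.max 0 (Num.min 1 u).

Lemma clamp_itv u : 0 <= clamp u <= 1.
Proof. by rewrite /clamp le_max lexx ge_max ge_min lexx ler01. Qed.

Lemma clamp_id u : 0 <= u <= 1 -> clamp u = u.
Proof. by move=> /andP[u0 u1]; rewrite /clamp min_r // max_r. Qed.

Lemma clamp_contraction u v : `|clamp u - clamp v| <= `|u - v|.
Proof. exact: le_trans (dist_maxl _ _ _) (dist_minl _ _ _). Qed.

Lemma clamp_cont (D : metricType R) (g : R -> D) :
  (forall u e, 0 <= u <= 1 -> 0 < e -> exists2 r, 0 < r &
     forall v, 0 <= v <= 1 -> `|v - u| < r -> mdist (g u) (g v) < e) ->
  continuous (g \o clamp).
Proof.
move=> gc; apply/cont_pathP => u e e0.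
have [r r0 rP] := gc (clamp u) e (clamp_itv u) e0.
exists r => // v vu; apply: rP; first exact: clamp_itv.
exact: le_lt_trans (clamp_contraction _ _) vu.
Qed.

Lemma within_clamp_cont (D : metricType R) (g : R -> D) :
  {within unit_interval R, continuous g} -> continuous (g \o clamp).
Proof.
move=> gc; apply: clamp_cont => u e u01 e0.
have /subspace_continuousP/(_ u) := gc.
move=> /(_ (iffRL (unit_intervalP u) u01)) /cvg_distP/(_ e e0).
rewrite near_withinE => /nbhs_ballP[r r0 rP]; exists r => // v v01 vu.
apply: rP; first by rewrite /ball/= distrC.
exact/unit_intervalP.
Qed.

Lemma dist_cont (D : metricType R) (g : R -> D) (x : D) :
  continuous g -> continuous (fun u => mdist x (g u)).
Proof.
move=> /cont_pathP gc; apply/cont_realP => u e e0.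
have [r r0 rP] := gc u e e0; exists r => // v /rP.
by apply: le_lt_trans; rewrite (metric_sym (g u)); exact: mdist_contraction.
Qed.

Lemma closed_superlevel (f : R -> R) (p : R) : continuous f -> closed [set u | p <= f u].
Proof.
move=> fc.
rewrite (_ : [set u | p <= f u] = f @^-1` [set x | p <= x]) //.
by apply: closed_comp => [x _|]; [exact: fc|exact: closed_ge].
Qed.

(** On a compact interval, a map that factors through another one does so
    continuously: the times at which b is far from b t0 form a compact set, on
    which a stays at a positive distance from a t0. *)
Lemma factor_cont (Z Y : metricType R) (a : R -> Z) (b : R -> Y) (c d t0 : R) :
  continuous a -> continuous b -> c <= t0 <= d ->
  (forall t, c <= t <= d -> a t = a t0 -> b t = b t0) ->
  forall e, 0 < e -> exists2 r, 0 < r & forall t, c <= t <= d ->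
    mdist (a t0) (a t) < r -> mdist (b t0) (b t) < e.
Proof.
move=> ac bc t0cd ab e e0.
pose C := `[c, d]%classic `&` [set t | e <= mdist (b t0) (b t)].
have cC : compact C.
  apply: compact_closedI; first exact: segment_compact.
  exact/closed_superlevel/dist_cont.
have [[t1 Ct1]|C0] := pselect (C !=set0).
  have dc : {within C, continuous (fun t => mdist (a t0) (a t))}.
    exact/continuous_subspaceT/dist_cont.
  have [|m + mmin] := compact_EVT_min _ cC dc; first by exists t1.
  rewrite inE => -[/=]; rewrite in_itv/= => mcd em.
  exists (mdist (a t0) (a m)).
    rewrite mdist_gt0; apply/eqP => am.
    by move: em; rewrite (ab m mcd (esym am)) mdistxx leNgt e0.
  move=> t tcd; rewrite !ltNge; apply: contraNN => et; apply: mmin.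
  by rewrite inE; split => //=; rewrite in_itv.
exists 1 => // t tcd _; rewrite ltNge; apply/negP => et; apply: C0; exists t.
by split => //=; rewrite in_itv.
Qed.

Lemma running_max (u : R -> R) : continuous u ->
  exists M : R -> R, [/\ continuous M, forall s t, s <= t -> M s <= M t,
    forall t, 0 <= t -> u t <= M t & forall t, exists2 a, 0 <= a <= Num.max 0 t & M t = u a].
Proof.
move=> uc.
have /choice[m mP] : forall t, exists a, 0 <= a <= Num.max 0 t /\
    forall b, 0 <= b <= Num.max 0 t -> u b <= u a.
  move=> t; have T0 : 0 <= Num.max 0 t by rewrite le_max lexx.
  have [|a + aP] := @EVT_max R u 0 (Num.max 0 t) T0; first exact: continuous_subspaceT.
  rewrite in_itv/= => a0; exists a; split => // b b0; apply: aP; by rewrite in_itv.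
exists (u \o m); split.
- have /cont_realP uc' := uc; apply/cont_realP => t e e0.
  pose T := Num.max 0 t.
  have e2 : 0 < e / 2 by rewrite divr_gt0.
  have [r r0 rP] := uc' T (e / 2) e2; exists r => // s st.
  pose S := Num.max 0 s.
  have ST : `|S - T| < r by apply: le_lt_trans st; exact: dist_maxl.
  have [/andP[a0 aS] ma] := mP s; have [/andP[b0 bT] mb] := mP t.
  rewrite -/S in aS ma; rewrite -/T in bT mb.
  have S0 : 0 <= S by rewrite /S le_max lexx.
  have T0 : 0 <= T by rewrite /T le_max lexx.
  have near1 v : `|v - T| < r -> u T - e / 2 < u v < u T + e / 2.
    by move=> /rP; rewrite ltr_norml; lra.
  rewrite /=; have [TS|TS] := leP T S.
    have h1 : u (m t) <= u (m s) by apply: ma; rewrite b0 /=; lra.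
    have h2 : u T <= u (m t) by apply: mb; rewrite T0 lexx.
    have h3 : u (m s) < u (m t) + e / 2.
      have [aT|aT] := leP (m s) T; first by have := mb _ (introT andP (conj a0 aT)); lra.
      have /andP[_] : u T - e / 2 < u (m s) < u T + e / 2; last by lra.
      apply: near1; rewrite gtr0_norm ?subr_gt0 //.
      by move: ST; rewrite ger0_norm ?subr_ge0 //; lra.
    rewrite ltr_norml; lra.
  have h1 : u (m s) <= u (m t) by apply: mb; rewrite a0 /=; lra.
  have /andP[h2 _] := near1 _ ST.
  have h2' : u S <= u (m s) by apply: ma; rewrite S0 lexx.
  have h3 : u (m t) < u (m s) + e.
    have [bS|bS] := leP (m t) S; first by have := ma _ (introT andP (conj b0 bS)); lra.
    have /andP[_] : u T - e / 2 < u (m t) < u T + e / 2; last by lra.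
    apply: near1; rewrite ler0_norm ?subr_le0 //.
    by move: ST; rewrite ltr0_norm ?subr_lt0 //; lra.
  rewrite ltr_norml; lra.
- move=> s t st /=; have [/andP[a0 aS] ma] := mP s; have [b0 mb] := mP t.
  apply: mb; rewrite a0 /=; apply: le_trans aS _.
  by rewrite ge_max !le_max lexx /= st orbT.
- by move=> t t0 /=; have [_] := mP t; apply; rewrite t0 le_max lexx orbT.
- by move=> t; exists (m t) => //; have [] := mP t.
Qed.

End arcs_in_paths.

Section loop_erasure.
Context {R : realType} (D : metricType R) (g : R -> D).
Hypothesis g_cont : continuous g.

(** A set U of times which can be deleted from the path g: on each component of
    U the path makes a loop. *)
Definition loops (U : set R) := [/\ open U, forall u, U u -> 0 < u < 1
  & forall a b, ~ U a -> ~ U b -> a < b -> (forall u, a < u < b -> U u) -> g a = g b].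

Lemma chain_absorbs_compact (F : set (set R)) (a b : R) : F !=set0 ->
  (forall X, F X -> open X) -> total_on F subset ->
  (forall u, a <= u <= b -> (\bigcup_(X in F) X) u) ->
  exists2 X, F X & forall u, a <= u <= b -> X u.
Proof.
move=> [X0 FX0] Fo Ftot Fab.
pose G := filter_from F (fun X => [set Y | F Y /\ X `<=` Y]).
have FG : Filter G.
  apply: filter_from_filter; first by exists X0.
  move=> X Y FX FY; have [XY|YX] := Ftot _ _ FX FY.
    by exists Y => // Z [FZ YZ]; split; split => //; exact: subset_trans YZ.
  by exists X => // Z [FZ XZ]; split; split => //; exact: subset_trans XZ.
have /compact_near_coveringP cK := @segment_compact R a b.
have [|X FX XP] := cK _ G (fun (X : set R) u => X u) FG.
  move=> u; rewrite /= in_itv/= => /Fab[X FX Xu].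
  exists (X, [set Y | F Y /\ X `<=` Y]) => /=.
    split; first by apply: open_nbhs_nbhs; split => //; exact: Fo.
    by exists X.
  by move=> [v Y] /= [Xv [FY XY]]; exact: XY.
exists X => // u uab; by apply: (XP X); [split|rewrite /= in_itv].
Qed.

(** A component of the union of a chain has its inner part, which is compact,
    inside a component of one member; the ends of the two components are close,
    and the loops of the member close up there. *)
Lemma loops_bigcup (F : set (set R)) :
  F `<=` loops -> total_on F subset -> loops (\bigcup_(X in F) X).
Proof.
move=> Fl Ftot; split.
- by apply: bigcup_open => X /Fl[].
- by move=> u [X /Fl[_ + _]]; apply.
move=> a b Ua Ub ab abU; apply: metric_eq0P => e e0.
have e2 : 0 < e / 2 by rewrite divr_gt0.
move/cont_pathP : (g_cont) => gc.
have [ra ra0 raP] := gc a _ e2; have [rb rb0 rbP] := gc b _ e2.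
pose r := Num.min (Num.min ra rb) ((b - a) / 2).
have r0 : 0 < r by rewrite !lt_min ra0 rb0 divr_gt0 // subr_gt0.
have rra : r <= ra by rewrite !ge_min lexx.
have rrb : r <= rb by rewrite !ge_min lexx orbT.
have rab : r <= (b - a) / 2 by rewrite !ge_min lexx orbT.
pose m1 := a + r / 2; pose m2 := b - r / 2.
have m12 : m1 < m2 by rewrite /m1 /m2; lra.
have mU u : m1 <= u <= m2 -> (\bigcup_(X in F) X) u.
  by move=> /andP[u1 u2]; apply: abU; move: u1 u2; rewrite /m1 /m2; lra.
have F0 : F !=set0.
  by have [|X FX _] := mU m1; [rewrite lexx /=; exact: ltW|exists X].
have [|X FX XP] := chain_absorbs_compact F0 _ Ftot mU; first by move=> X /Fl[].
have [oX X01 Xg] := Fl _ FX.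
have Xa : ~ X a by move=> Xa; apply: Ua; exists X.
have Xb : ~ X b by move=> Xb; apply: Ub; exists X.
have cX : closed (~` X) by exact: open_closedC.
have am1 : a <= m1 by rewrite /m1; lra.
have m2b : m2 <= b by rewrite /m2; lra.
have [a' [/andP[aa' a'm] Xa' a'P]] := last_hit cX am1 Xa.
have [b' [/andP[mb' b'b] Xb' b'P]] := first_hit cX m2b Xb.
have ga : mdist (g a) (g a') < e / 2.
  by apply: raP; rewrite ger0_norm ?subr_ge0 //; move: a'm; rewrite /m1; lra.
have gb : mdist (g b) (g b') < e / 2.
  by apply: rbP; rewrite ler0_norm ?subr_le0 //; move: mb'; rewrite /m2; lra.
suff gab : g a' = g b'.
  have := metric_triangle (g a) (g a') (g b); rewrite {2}gab (metric_sym (g b') (g b)); lra.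
apply: Xg => //; first by lra.
move=> u /andP[u1 u2]; apply: contrapT => Xu.
have [um|um] := leP u m1; first by apply: (a'P u) => //; rewrite u1.
have [um'|um'] := leP m2 u; first by apply: (b'P u) => //; rewrite um'.
by apply: Xu; apply: XP; rewrite !ltW.
Qed.

(** If g s = g t then adding ]s, t[ to U gives again a deletable set, so that it
    already lies in a maximal one. *)
Lemma maximal_loops : exists U, loops U /\
  forall s t, 0 <= s -> s < t -> t <= 1 -> ~ U s -> ~ U t -> g s = g t ->
    forall u, s < u < t -> U u.
Proof.
have [U [lU Umax]] := Zorn_bigcup loops_bigcup.
exists U; split => // s t s0 st t1 Us Ut gst u ust.
apply: contrapT => Uu.
apply: (Umax (U `|` `]s, t[%classic)).
  split; first by move=> v; left.
  by move=> sub; apply: Uu; apply: sub; right; rewrite /= in_itv.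
have [oU U01 Ug] := lU; split.
- by apply: openU => //; exact: interval_open.
- move=> v [/U01//|]; rewrite /= in_itv/= => /andP[sv vt]; apply/andP; split.
    exact: le_lt_trans sv.
  exact: lt_le_trans vt _.
move=> a b Ua Ub ab abU.
have Ua' : ~ U a by move=> ?; apply: Ua; left.
have Ub' : ~ U b by move=> ?; apply: Ub; left.
have Ia : ~ (s < a < t) by move=> ?; apply: Ua; right; rewrite /= in_itv.
have Ib : ~ (s < b < t) by move=> ?; apply: Ub; right; rewrite /= in_itv.
have simple : (b <= s \/ t <= a) -> g a = g b.
  move=> bsta; apply: Ug => // v vab; have [//|] := abU v vab.
  by rewrite /= in_itv/= => vst; case: bsta; move: vab vst; lra.
have [bs|sb] := leP b s; first by apply: simple; left.
have [ta|at_] := leP t a; first by apply: simple; right.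
have as_ : a <= s by rewrite leNgt; apply/negP => sa; apply: Ia; rewrite sa.
have tb : t <= b by rewrite leNgt; apply/negP => bt; apply: Ib; rewrite sb.
have noI v : ~ (s < v < t) -> ~ U v -> ~ (a < v < b).
  move=> nI nU /abU[//|]; by rewrite /= in_itv.
have -> : a = s.
  apply/eqP; rewrite eq_le as_ leNgt; apply/negP => as'.
  by apply: (noI s) => //; [rewrite ltxx|rewrite as' sb].
have -> // : b = t.
apply/eqP; rewrite eq_le tb andbT leNgt; apply/negP => bt'.
by apply: (noI t) => //; [rewrite ltxx andbF|rewrite at_ bt'].
Qed.

(** Deleting a maximal set of loops leaves a path whose fibres are intervals: the
    path waits at the last time that was kept. Its modulus of continuity is not
    worse than that of g, since over any interval of times it takes values that g
    takes in that interval, or is constant. *)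
Lemma loop_erasure : exists s : R -> D, [/\ continuous s, s 0 = g 0, s 1 = g 1,
  forall t, exists2 u, 0 <= u <= 1 & s t = g u
  & forall a b u, 0 <= a -> a <= u -> u <= b -> b <= 1 -> s a = s b -> s u = s a].
Proof.
have [U [[oU U01 Ug] Umin]] := maximal_loops.
have cU : closed (~` U) by exact: open_closedC.
have U0 : ~ U 0 by move/U01; rewrite ltxx.
have U1 : ~ U 1 by move/U01; rewrite ltxx andbF.
have /choice[k kP] : forall t, exists m, 0 <= t -> [/\ 0 <= m <= t, ~ U m
    & forall u, m < u <= t -> U u].
  move=> t; have [t0|t0] := leP 0 t; last by exists 0; lra.
  have [m [m0 Um mP]] := last_hit cU t0 U0.
  by exists m => _; split => // u /mP/contrapT.
have k01 t : 0 <= t <= 1 -> 0 <= k t <= 1.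
  by move=> /andP[t0 t1]; have [/andP[k0 kt] _ _] := kP t t0; rewrite k0 (le_trans kt).
have kmono s t : 0 <= s -> s <= t -> k s <= k t.
  move=> s0 st; have [/andP[k0 ks] Us _] := kP s s0.
  have [_ Ut tU] := kP t (le_trans s0 st).
  rewrite leNgt; apply/negP => kk; apply: Us; apply: tU.
  by rewrite kk (le_trans ks).
have mod_cont s t : 0 <= s -> s <= t -> t <= 1 -> g (k s) = g (k t) \/
    exists n m, [/\ s <= n <= t, s <= m <= t, g (k s) = g n & g (k t) = g m].
  move=> s0 st t1; have [/andP[ks0 kss] Us sU] := kP s s0.
  have [/andP[kt0 ktt] Ut tU] := kP t (le_trans s0 st).
  (* n is the first time kept after s; between k s and n there is only a loop *)
  have [kts|skt] := leP (k t) s.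
    left; congr g; apply/eqP; rewrite eq_le kmono //= leNgt; apply/negP => kk.
    by apply: Ut; apply: sU; rewrite kk.
  right; have [n [/andP[sn nk] Un nP]] := first_hit cU (ltW skt) Ut.
  exists n, (k t); split; [by rewrite sn (le_trans nk)|by rewrite ltW|idtac|by []].
  have [<-|nks] := eqVneq (k s) n => //.
  apply: Ug => //; first by rewrite lt_neqAle nks (le_trans kss).
  move=> u /andP[u1 u2]; have [us|su] := leP u s; first by apply: sU; rewrite u1.
  by apply: contrapT; apply: nP; rewrite ltW.
have fib a b u : 0 <= a -> a <= u -> u <= b -> b <= 1 -> g (k a) = g (k b) -> g (k u) = g (k a).
  move=> a0 au ub b1 gab.
  have b0 : 0 <= b by lra.
  have u0 : 0 <= u by lra.
  have kau := kmono _ _ a0 au; have kub := kmono _ _ u0 ub.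
  have [_ Ua _] := kP a a0; have [_ Ub _] := kP b b0; have [_ Uu _] := kP u u0.
  have a01 : 0 <= a <= 1 by lra.
  have b01 : 0 <= b <= 1 by lra.
  have /andP[ka0 ka1] := k01 a a01; have /andP[kb0 kb1] := k01 b b01.
  have [->//|nau] := eqVneq (k u) (k a).
  have [->//|nub] := eqVneq (k u) (k b).
  exfalso; apply: Uu.
  have lt1 : k a < k u by rewrite lt_neqAle eq_sym nau.
  have lt2 : k u < k b by rewrite lt_neqAle nub.
  by apply: (Umin (k a) (k b)) => //; [exact: lt_trans lt2|rewrite lt1].
exists ((g \o k) \o clamp); split.
- apply: clamp_cont => u e /andP[u0 u1] e0.
  have e2 : 0 < e / 2 by rewrite divr_gt0.
  move/cont_pathP : (g_cont) => /(_ u _ e2)[r r0 rP].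
  exists r => // v /andP[v0 v1] vu /=.
  have close n m : `|n - u| < r -> `|m - u| < r -> mdist (g n) (g m) < e.
    move=> /rP h1 /rP h2; have := metric_triangle (g n) (g u) (g m).
    rewrite (metric_sym (g n) (g u)); lra.
  have [uv|vu'] := leP u v.
    have [->|[n [m [/andP[n1 n2] /andP[m1 m2] -> ->]]]] := mod_cont _ _ u0 uv v1.
      by rewrite mdistxx.
    move: vu; rewrite ger0_norm ?subr_ge0 // => vu.
    by apply: close; rewrite ger0_norm ?subr_ge0 //; lra.
  have [->|[n [m [/andP[n1 n2] /andP[m1 m2] -> ->]]]] := mod_cont _ _ v0 (ltW vu') u1.
    by rewrite mdistxx.
  move: vu; rewrite ltr0_norm ?subr_lt0 // => vu.
  by apply: close; rewrite ler0_norm ?subr_le0 //; lra.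
- rewrite /= clamp_id ?lexx ?ler01 //; congr g.
  have [/andP[? ?] _ _] := kP 0 (lexx 0); apply/eqP; rewrite eq_le; lra.
- rewrite /= clamp_id ?lexx ?ler01 //; congr g.
  have [/andP[k0 k1] Uk kU] := kP 1 ler01.
  apply/eqP; rewrite eq_le k1 leNgt; apply/negP => kk.
  by apply: U1; apply: kU; rewrite kk lexx.
- by move=> t /=; exists (k (clamp t)) => //; apply: k01; exact: clamp_itv.
- move=> a b u a0 au ub b1 /=.
  rewrite !clamp_id; [exact: fib| | |]; lra.
Qed.

End loop_erasure.

Section arcs.
Context {R : realType}.

Variable D : metricType R.

(** p adds up, with weights 2^-n, the running maxima of the distances to
    s (q n) after the time q n, where q n runs through the rationals. If s t and
    s t' differ, then a rational slightly after t contributes 0 until t, and a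
    positive amount by the time t'. Where s is constant no running maximum
    grows. *)
Lemma monotone_parameter (s : R -> D) : continuous s ->
  exists p : R -> R, [/\ continuous p, forall t t', t <= t' -> p t <= p t',
    forall t t', 0 <= t -> t < t' -> t' <= 1 -> s t <> s t' -> p t < p t'
  & forall t t', 0 <= t -> t <= t' -> t' <= 1 ->
      (forall u, t <= u <= t' -> s u = s t) -> p t' <= p t].
Proof.
move=> sc; have /cont_pathP sc' := sc.
pose q n : R := ratr (odflt 0%Q (unpickle n)).
pose w n (a : R) : R := Num.min 1 (mdist (s (q n)) (s (Num.max (q n) a))).
have wc n : continuous (w n).
  apply/cont_realP => u e e0.
  have [r r0 rP] := sc' (Num.max (q n) u) e e0; exists r => // v vu.
  apply: le_lt_trans (dist_minl _ _ _) _; apply: le_lt_trans (mdist_contraction _ _ _) _.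
  by rewrite metric_sym; apply: rP; exact: le_lt_trans (dist_maxl _ _ _) vu.
have w0 n a : 0 <= w n a by rewrite le_min ler01 mdist_ge0.
have w1 n a : w n a <= 1 by rewrite ge_min lexx.
have wq n a : a <= q n -> w n a = 0.
  by move=> aq; rewrite /w max_l // mdistxx min_r.
have /choice[M MP] : forall n, exists M : R -> R,
    [/\ continuous M, forall s t, s <= t -> M s <= M t,
    forall t, 0 <= t -> w n t <= M t & forall t, exists2 a, 0 <= a <= Num.max 0 t & M t = w n a].
  by move=> n; exact: running_max (wc n).
have M01 n t : 0 <= M n t <= 1.
  by have [_ _ _ /(_ t)[a _ ->]] := MP n; rewrite w0 w1.
have M0 n t : 0 <= t -> t <= q n -> M n t = 0.
  move=> t0 tq; have [_ _ _ /(_ t)[a /andP[a0 +] ->]] := MP n.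
  by rewrite max_r // => at_; apply: wq; exact: le_trans tq.
pose h k : R := 2^-1 ^+ k.
have h0 k : 0 < h k by rewrite exprn_gt0 // invr_gt0.
pose S n (t : R) := \sum_(k < n) h k * M k t.
have S_succ n t : S n.+1 t = S n t + h n * M n t by rewrite /S big_ord_recr.
have S_cont n : continuous (S n).
  elim: n => [|n IH].
    by rewrite (_ : S 0%N = fun=> 0); [move=> x; exact: cvg_cst|apply/funext => x; rewrite /S big_ord0].
  rewrite (_ : S n.+1 = fun t => S n t + h n * M n t); last by apply/funext => x.
  move=> x; apply: cvgD; first exact: IH.
  by apply: cvgM; [exact: cvg_cst|have [Mc _ _ _] := MP n; exact: Mc].
have S_mono n t t' : t <= t' -> S n t <= S n t'.
  move=> tt'; apply: ler_sum => k _; rewrite ler_wpM2l ?(ltW (h0 _)) //.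
  by have [_ + _ _] := MP k; apply.
have [p pP] : exists p : R -> R^o, forall e, 0 < e -> exists N, forall n x, (N <= n)%N ->
    mdist (S n x : R^o) (p x) < e.
  apply: uniform_limit; first exact: real_seq_complete.
  move=> e e0.
  have Sg n t : mdist (S n t : R^o) (S n.+1 t) <= 1 * 2^-1 ^+ n.
    rewrite /mdist /= S_succ addrC addKr.
    have /andP[m0 m1] := M01 n t; rewrite ger0_norm ?mulr_ge0 ?(ltW (h0 _)) //.
    by rewrite mul1r -/(h n) ler_piMr ?(ltW (h0 _)).
  have Sc := geom_cauchy Sg.
  have [N NP] := geom_small (divr_gt0 e0 (ltr0Sn R 3)).
  have NN := NP N (leqnn _).
  exists N => m n t Nm Nn; have := Sc _ _ t Nm; have := Sc _ _ t Nn.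
  have := metric_triangle (S m t : R^o) (S N t) (S n t).
  rewrite (metric_sym (S m t : R^o) (S N t)); move: NN; set z := _ ^+ N; lra.
have pS e : 0 < e -> exists N, forall n t, (N <= n)%N -> `|p t - S n t| < e.
  by move=> /pP.
have p_mono t t' : t <= t' -> p t <= p t'.
  move=> tt'; rewrite leNgt; apply/negP => pp.
  have [N /(_ N _ (leqnn _)) NP] := pS ((p t - p t') / 2) (divr_gt0 (eq_ind_r is_true pp (subr_gt0 _ _)) (ltr0Sn _ _)).
  have := NP t; have := NP t'; have := S_mono N _ _ tt'; rewrite !ltr_norml; lra.
have p_grow k t t' : t <= t' -> h k * (M k t' - M k t) <= p t' - p t.
  move=> tt'; rewrite leNgt; apply/negP => pp.
  pose e := h k * (M k t' - M k t) - (p t' - p t).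
  have e0 : 0 < e by rewrite /e; lra.
  have [N NP] := pS (e / 2) (divr_gt0 e0 (ltr0Sn _ _)).
  pose n := maxn N k.+1.
  have := NP n t (leq_maxl _ _); have := NP n t' (leq_maxl _ _).
  have : h k * (M k t' - M k t) <= S n t' - S n t.
    have kn : (k < n)%N by rewrite leq_max leqnn orbT.
    rewrite /S -sumrB (bigD1 (Ordinal kn)) //= mulrBr lerDl.
    apply: sumr_ge0 => i _; rewrite subr_ge0 ler_wpM2l ?(ltW (h0 _)) //.
    by have [_ + _ _] := MP i; apply.
  by rewrite !ltr_norml /e; lra.
exists p; split => //.
- exact: (@uniform_limit_cont R R R^o S p).
- move=> t t' t0 tt' t'1 stt'.
  have d0 : 0 < mdist (s t) (s t') by rewrite mdist_gt0; apply/eqP.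
  have [r r0 rP] := sc' t _ d0.
  have [|c] := @rat_in_itvoo R t (Num.min t' (t + r)).
    by rewrite lt_min tt' ltrDl.
  rewrite in_itv/= lt_min => /andP[tc /andP[ct' cr]].
  pose k := pickle c; have qk : q k = ratr c by rewrite /q pickleK.
  have Mt : M k t = 0 by apply: M0 => //; rewrite qk ltW.
  have Mt' : 0 < M k t'.
    have [_ _ wM _] := MP k; apply: lt_le_trans (wM t' _); last by rewrite (le_trans t0) // ltW.
    rewrite /w lt_min ltr01 qk max_r; last exact: ltW.
    rewrite mdist_gt0; apply/eqP => sc_t'.
    have := rP (ratr c); rewrite sc_t' ltxx => abs.
    by have // : false; apply: abs; rewrite gtr0_norm ?subr_gt0 //; lra.
  have := p_grow k t t' (ltW tt'); rewrite Mt subr0.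
  by have := mulr_gt0 (h0 k) Mt'; lra.
- move=> t t' t0 tt' t'1 st.
  have MM k : M k t' <= M k t.
    have [_ _ wM /(_ t')[a /andP[a0 +] ->]] := MP k.
    rewrite max_r; last exact: le_trans tt'.
    move=> at'; have [at_|ta] := leP a t.
      by apply: le_trans (wM _ a0) _; have [_ + _ _] := MP k; apply.
    have [aq|qa] := leP a (q k).
      by rewrite wq //; have /andP[] := M01 k t.
    have sa : s a = s t by apply: st; rewrite (ltW ta).
    have [tq|qt] := leP t (q k).
      have sq : s (q k) = s t by apply: st; rewrite tq (le_trans (ltW qa)).
      rewrite /w max_r; last exact: ltW.
      rewrite sa sq mdistxx min_r //.
      by have /andP[] := M01 k t.
    apply: le_trans (wM t t0); rewrite /w !max_r ?sa //; exact: ltW.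
  rewrite leNgt; apply/negP => pp.
  have [N /(_ N _ (leqnn _)) NP] := pS ((p t' - p t) / 2) (divr_gt0 (eq_ind_r is_true pp (subr_gt0 _ _)) (ltr0Sn _ _)).
  have : S N t' <= S N t by apply: ler_sum => k _; rewrite ler_wpM2l ?(ltW (h0 _)).
  by have := NP t; have := NP t'; rewrite !ltr_norml; lra.
Qed.

End arcs.

Section arc_existence.
Context {R : realType} (D : metricType R).

Definition injective_path (f : R -> D) :=
  continuous f /\ forall u v, 0 <= u <= 1 -> 0 <= v <= 1 -> f u = f v -> u = v.

(** After loop erasure the path is a function of its monotone parameter, and an
    injective one; factoring it through the parameter gives the arc. *)
Lemma path_contains_arc (g : R -> D) : continuous g -> g 0 <> g 1 ->
  exists f, [/\ injective_path f, f 0 = g 0, f 1 = g 1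
    & forall t, exists2 u, 0 <= u <= 1 & f t = g u].
Proof.
move=> gc g01; have [s [sc s0 s1 sg sfib]] := loop_erasure gc.
have [p [pc pmono pstrict pconst]] := monotone_parameter sc.
have s01 : s 0 <> s 1 by rewrite s0 s1.
have p01 : p 0 < p 1 by apply: pstrict.
have l0 : 0 < p 1 - p 0 by rewrite subr_gt0.
pose lev v : R := p 0 + clamp v * (p 1 - p 0).
have /choice[t tP] : forall v, exists t, 0 <= t <= 1 /\ p t = lev v.
  move=> v; have /andP[c0 c1] := clamp_itv v.
  have [||t t01 pt] := @ivt R p 0 1 (lev v) pc ler01.
  - by rewrite /lev lerDl mulr_ge0 // ltW.
  - by rewrite /lev -lerBrDl ler_piMl // ltW.
  by exists t.
have same a b : 0 <= a <= 1 -> 0 <= b <= 1 -> p a = p b -> s a = s b.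
  move=> /andP[a0 a1] /andP[b0 b1] pab; apply: contrapT => sab.
  have [ab|ba|ab] := ltgtP a b; last by apply: sab; rewrite ab.
  - by have := pstrict _ _ a0 ab b1 sab; rewrite pab ltxx.
  - by have := pstrict _ _ b0 ba a1 (nesym sab); rewrite pab ltxx.
have same' a b : 0 <= a <= 1 -> 0 <= b <= 1 -> s a = s b -> p a = p b.
  have aux c d : 0 <= c -> c <= d -> d <= 1 -> s c = s d -> p c = p d.
    move=> c0 cd d1 scd; apply/eqP; rewrite eq_le pmono //=; apply: pconst => // u /andP[cu ud].
    exact: sfib scd.
  move=> /andP[a0 a1] /andP[b0 b1] sab; have [ab|ba] := leP a b; first exact: aux.
  by apply/esym/aux => //; exact: ltW.
have lev_inj u v : 0 <= u <= 1 -> 0 <= v <= 1 -> lev u = lev v -> u = v.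
  move=> u01 v01; rewrite /lev !clamp_id // => /addrI/mulIf; apply.
  by rewrite gt_eqF.
exists (s \o t); split.
- split; last first.
    move=> u v u01 v01 /= stuv; apply: lev_inj => //.
    have [tu1 <-] := tP u; have [tv1 <-] := tP v; exact: same'.
  apply/cont_pathP => v e e0; have [tv01 ptv] := tP v.
  have [|r r0 rP] := @factor_cont R R^o D p s 0 1 (t v) pc sc tv01 _ e e0.
    by move=> u u01 pu; exact: same.
  exists (r / (p 1 - p 0)); first by rewrite divr_gt0.
  move=> u uv; have [tu01 ptu] := tP u; apply: rP => //.
  rewrite /mdist /= ptu ptv /lev opprD addrACA subrr add0r -mulrBl normrM (gtr0_norm l0).
  rewrite -ltr_pdivlMr //; exact: le_lt_trans (clamp_contraction _ _) uv.
- have [t01 pt] := tP 0; rewrite /= -s0; apply: same; rewrite ?lexx ?ler01 //.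
  by rewrite pt /lev clamp_id ?mul0r ?addr0 // lexx ler01.
- have [t01 pt] := tP 1; rewrite /= -s1; apply: same; rewrite ?lexx ?ler01 //.
  by rewrite pt /lev clamp_id ?lexx ?ler01 // mul1r addrC subrK.
- by move=> u /=; exact: sg.
Qed.

Lemma injective_path_inverse (f : R -> D) : injective_path f ->
  exists k : D -> R, (forall u, 0 <= u <= 1 -> k (f u) = u) /\
    forall u e, 0 <= u <= 1 -> 0 < e -> exists2 r, 0 < r & forall v, 0 <= v <= 1 ->
      mdist (f u) (f v) < r -> `|k (f v) - k (f u)| < e.
Proof.
move=> [fc finj].
have /choice[k kP] : forall x, exists u, (exists2 v, 0 <= v <= 1 & f v = x) -> 0 <= u <= 1 /\ f u = x.
  move=> x; have [[v v01 <-]|nv] := pselect (exists2 v, 0 <= v <= 1 & f v = x); first by exists v.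
  by exists 0.
have kf u : 0 <= u <= 1 -> k (f u) = u.
  move=> u01; have [|k01 fk] := kP (f u); first by exists u.
  exact: finj.
exists k; split => // u e u01 e0.
have idc : continuous (fun x : R => x : R^o) by move=> x.
have [|r r0 rP] := @factor_cont R D R^o f (fun x : R => x : R^o) 0 1 u fc idc u01 _ e e0.
  by move=> v v01 /finj; apply.
by exists r => // v v01 /rP; rewrite /mdist /= !kf //; apply.
Qed.

Lemma injective_path_arc (f : R -> D) : injective_path f ->
  is_arc_between R (f 0) (f 1) (f @` unit_interval R).
Proof.
move=> fi; have [k [kf kc]] := injective_path_inverse fi.
case: fi => fc finj.
right; exists f, k; split => //; split.
- exact: continuous_subspaceT.
- apply/subspace_continuousP => _ [u /unit_intervalP u01 <-].
  apply/(@cvgrPdist_lt _ R^o) => e e0; rewrite near_withinE.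
  have [r r0 rP] := kc u e u01 e0; apply/nbhs_distP; exists r => // y yr [v /unit_intervalP v01 yv].
  by rewrite distrC -yv; apply: rP => //; rewrite yv.
- by move=> u u01; exists u.
- by move=> _ [u /unit_intervalP u01 <-]; apply/unit_intervalP; rewrite kf.
- split; first by move=> u /unit_intervalP; exact: kf.
  by move=> _ [u /unit_intervalP u01 <-]; rewrite kf.
Qed.

(** In a dendrite this is the arc with endpoints x and y, by [arc_param]. Concatenating
    and cutting paths proves most inclusions between such sets directly. *)
Definition arc (x y : D) : set D := [set z | forall g : R -> D, continuous g ->
  g 0 = x -> g 1 = y -> exists2 u, 0 <= u <= 1 & g u = z].

(** Every path from x to y contains an arc from x to y, and there is only one. *)
Lemma arc_param : is_dendrite D -> forall x y, x <> y ->
  exists f, [/\ injective_path f, f 0 = x, f 1 = y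
    & forall z, arc x y z <-> exists2 u, 0 <= u <= 1 & f u = z].
Proof.
move=> [_ _ uarc] x y xy.
have [A [AP Auniq]] := uarc x y.
have [g [gc g0 g1]] : exists g : R -> D, [/\ continuous g, g 0 = x & g 1 = y].
  case: AP => [[//]|[f [k [[fc _ _ _ _] f0 f1]]]].
  exists (f \o clamp); split; first exact: within_clamp_cont.
    by rewrite /= clamp_id ?lexx ?ler01.
  by rewrite /= clamp_id ?lexx ?ler01.
have gA (g' : R -> D) : continuous g' -> g' 0 = x -> g' 1 = y ->
    exists f, [/\ injective_path f, f 0 = x, f 1 = y, A = f @` unit_interval R
      & forall t, exists2 u, 0 <= u <= 1 & f t = g' u].
  move=> g'c g'0 g'1; have g01 : g' 0 <> g' 1 by rewrite g'0 g'1.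
  have [f [fi f0 f1 fg]] := path_contains_arc g'c g01.
  exists f; rewrite f0 f1; split => //; apply: Auniq.
  by have := injective_path_arc fi; rewrite f0 f1 g'0 g'1.
have [f [fi f0 f1 Af _]] := gA g gc g0 g1.
exists f; split => // z; split; last first.
  move=> [u u01 fu] g' g'c g'0 g'1.
  have [f' [_ _ _ Af' f'g]] := gA g' g'c g'0 g'1.
  have : A z by rewrite Af; exists u => //; exact/unit_intervalP.
  by rewrite Af' => -[v _ <-]; have [w w01 ->] := f'g v; exists w.
move=> arcz; have [fc _] := fi; have [u u01 fu] := arcz f fc f0 f1; by exists u.
Qed.

End arc_existence.

(** * Arcs of a dendrite *)

Section arc_algebra.
Context {R : realType} (D : metricType R).

Lemma glue_cont (g1 g2 : R -> D) (c : R) : continuous g1 -> continuous g2 -> g1 c = g2 c ->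
  continuous (fun u => if u <= c then g1 u else g2 u).
Proof.
move=> /cont_pathP g1c /cont_pathP g2c g12; apply/cont_pathP => u e e0.
have [r1 r10 r1P] := g1c u e e0; have [r2 r20 r2P] := g2c u e e0.
have [uc|cu|uc] := ltgtP u c.
- exists (Num.min r1 (c - u)); first by rewrite lt_min r10 subr_gt0.
  move=> v; rewrite lt_min => /andP[v1 v2]; have vc : v <= c by have := ler_norm (v - u); lra.
  by rewrite vc; exact: r1P.
- exists (Num.min r2 (u - c)); first by rewrite lt_min r20 subr_gt0.
  move=> v; rewrite lt_min => /andP[v1 v2].
  have vc : c < v by have := ler_norm (u - v); rewrite distrC; lra.
  by rewrite leNgt vc /=; exact: r2P.
- exists (Num.min r1 r2); first by rewrite lt_min r10.
  move=> v; rewrite lt_min => /andP[v1 v2]; case: ifP => _; first exact: r1P.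
  by rewrite uc g12 -uc; exact: r2P.
Qed.

Lemma affine_cont (a b : R) : continuous (fun u : R => a * u + b).
Proof.
by move=> u; apply: cvgD; [apply: cvgM; [exact: cvg_cst|exact: cvg_id]|exact: cvg_cst].
Qed.

Lemma reparam_cont (g : R -> D) (a b : R) : continuous g -> continuous (fun u => g (a * u + b)).
Proof. by move=> gc u; apply: (@continuous_comp _ _ _ (fun u => a * u + b) g); [exact: affine_cont|exact: gc]. Qed.

Lemma path_cat (g1 g2 : R -> D) : continuous g1 -> continuous g2 -> g1 1 = g2 0 ->
  exists g : R -> D, [/\ continuous g, g 0 = g1 0, g 1 = g2 1 & forall u, 0 <= u <= 1 ->
    exists2 v, 0 <= v <= 1 & g u = g1 v \/ g u = g2 v].
Proof.
move=> g1c g2c g12.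
exists (fun u => if u <= 2^-1 then g1 (2 * u + 0) else g2 (2 * u + -1)); split.
- apply: (@glue_cont (fun u => g1 (2 * u + 0)) (fun u => g2 (2 * u + -1))); try exact: reparam_cont.
  by rewrite addr0 divff // subrr.
- by rewrite invr_ge0 ler0n mulr0 addr0.
- have -> : (1 <= 2^-1 :> R) = false by apply/negbTE; rewrite -ltNge; lra.
  by congr g2; lra.
- move=> u /andP[u0 u1]; case: leP => u2.
    by exists (2 * u + 0); [lra|left].
  by exists (2 * u + -1); [lra|right].
Qed.

Lemma arc_left (x y : D) : arc x y x.
Proof. by move=> g _ g0 _; exists 0; rewrite // lexx ler01. Qed.

Lemma arc_right (x y : D) : arc x y y.
Proof. by move=> g _ _ g1; exists 1; rewrite // lexx ler01. Qed.

Lemma arcxx (x z : D) : arc x x z -> z = x.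
Proof. by move=> /(_ (fun=> x)) [] // u; exact: cvg_cst. Qed.

Lemma arc_sym (x y z : D) : arc x y z -> arc y x z.
Proof.
move=> xyz g gc g0 g1.
have [||u u01 <-] := xyz _ (reparam_cont (a := -1) (b := 1) gc).
- by rewrite mulr0 add0r.
- by rewrite mulr1 addNr.
by exists (-1 * u + 1) => //; move: u01; lra.
Qed.

Lemma arc_tri (z x y w : D) : arc x y w -> arc x z w \/ arc z y w.
Proof.
move=> xyw; apply: contrapT => /not_orP[].
move=> /existsNP[g1 /not_implyP[g1c /not_implyP[g10 /not_implyP[g11 n1]]]].
move=> /existsNP[g2 /not_implyP[g2c /not_implyP[g20 /not_implyP[g21 n2]]]].
have g12 : g1 1 = g2 0 by rewrite g11.
have [g [gc g0 g1' gP]] := path_cat g1c g2c g12.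
have [|//|u u01 gu] := xyw g gc; first by rewrite g0.
  by rewrite g1'.
have [v v01 [gv|gv]] := gP u u01.
  by apply: n1; exists v; rewrite // -gv.
by apply: n2; exists v; rewrite // -gv.
Qed.

Lemma arc_sub (x y z w : D) : arc x y z -> arc x z w -> arc x y w.
Proof.
move=> xyz xzw g gc g0 g1; have [t t01 gt] := xyz g gc g0 g1.
have [||u u01 <-] := xzw _ (reparam_cont (a := t) (b := 0) gc).
- by rewrite mulr0 addr0.
- by rewrite mulr1 addr0.
exists (t * u + 0) => //; rewrite addr0.
by move: u01 t01 => /andP[u0 u1] /andP[t0 t1]; rewrite mulr_ge0 //= mulr_ile1.
Qed.

Hypothesis D_dendrite : is_dendrite D.

(** Along a parameter of the arc from x to w, the piece that ends at z contains w
    only if z = w. *)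
Lemma arc_antisym (x z w : D) : arc x w z -> arc x z w -> z = w.
Proof.
move=> xwz xzw; have [xw|xw] := pselect (x = w).
  by move: xwz; rewrite xw => /arcxx.
have [f [[fc finj] f0 f1 fP]] := arc_param D_dendrite xw.
have /fP[t t01 ft] := xwz.
have [||u u01 fu] := xzw _ (reparam_cont (a := t) (b := 0) fc).
- by rewrite mulr0 addr0.
- by rewrite mulr1 addr0.
rewrite -ft -f1; congr f.
move: u01 t01 => /andP[u0 u1] /andP[t0 t1].
have : t * u + 0 = 1.
  by apply: finj; rewrite ?lexx ?ler01 ?f1 // addr0 mulr_ge0 //= mulr_ile1.
rewrite addr0 => tu; apply/eqP; rewrite eq_le t1 /= -tu; exact: ler_piMr.
Qed.

Lemma arc_antisymr (x z w : D) : arc w x z -> arc z x w -> z = w.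
Proof. by move=> /arc_sym h1 /arc_sym h2; exact: arc_antisym h1 h2. Qed.

Lemma arc_total (x y w z : D) : arc x y w -> arc x y z -> arc x w z \/ arc x z w.
Proof.
move=> xyw xyz; have [|wyz] := arc_tri w xyz; first by left.
have [|zyw] := arc_tri z xyw; first by right.
by left; rewrite (arc_antisymr wyz zyw); exact: arc_right.
Qed.

Lemma arc_convex (x y w z v : D) : arc x y w -> arc x y z -> arc w z v -> arc x y v.
Proof.
move=> xyw xyz wzv; have [xwz|xzw] := arc_total xyw xyz.
- apply: (arc_sub xyw); apply/arc_sym; apply: arc_sub wzv; exact: arc_sym.
- apply: (arc_sub xyz); apply/arc_sym; apply: (arc_sub (z := w)); [exact: arc_sym|exact: arc_sym].
Qed.

Lemma arc_compact (x y : D) : compact (arc x y).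
Proof.
have [->|/eqP xy] := eqVneq x y.
  rewrite (_ : arc y y = [set y]); first exact: compact_set1.
  apply/seteqP; split => z; first exact: arcxx.
  move=> ->; exact: arc_left.
have [f [[fc _] _ _ fP]] := arc_param D_dendrite xy.
rewrite (_ : arc x y = f @` `[0, 1]%classic).
  by apply: continuous_compact; [exact: continuous_subspaceT|exact: segment_compact].
apply/seteqP; split => z.
  by move=> /fP[u u01 <-]; exists u => //=; rewrite in_itv.
by move=> [u + <-]; rewrite /= in_itv/= => u01; apply/fP; exists u.
Qed.

Lemma arc_closed (x y : D) : closed (arc x y).
Proof. by apply: compact_closed; [exact: metric_hausdorff|exact: arc_compact]. Qed.

Lemma arc_small (e : R) : 0 < e -> exists2 r, 0 < r & forall x y z : D, mdist x y < r ->
  arc x y z -> mdist x z < e.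
Proof.
have [[D_compact _ _] D_lc _] := D_dendrite.
move=> e0; have [r r0 rP] := locally_path_connected D_compact D_lc e0.
exists r => // x y z xy xyz; have [g [gc g0 g1 ge]] := rP x y xy.
by have [u _ <-] := xyz g gc g0 g1.
Qed.

End arc_algebra.

(** * Subtrees, retractions and endpoints *)

Section trees.
Context {R : realType} (D : metricType R).
Hypothesis D_dendrite : is_dendrite D.

Definition tree (T : set D) := [/\ closed T, T !=set0
  & forall x y z, T x -> T y -> arc x y z -> T z].

Lemma tree_arc (x y : D) : tree (arc x y).
Proof.
split; first exact: arc_closed.
- by exists x; exact: arc_left.
- by move=> a b c; exact: arc_convex.
Qed.

(** The gate of y in T is the point at which every way from y to T enters T. *)
Definition gate (T : set D) (y t : D) := T t /\ forall a, T a -> arc y a t.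

(** The first point t of T on an arc from y to T belongs to every other arc from
    y to a point a of T: the points of the first arc before t belong to that arc
    too, and it is closed. *)
Lemma gate_exists (T : set D) (y : D) : tree T -> exists t, gate T y t.
Proof.
move=> [cT [a0 Ta0] convT]; have [Ty|Ty] := pselect (T y).
  by exists y; split => // a _; exact: arc_left.
have ya0 : y <> a0 by move=> ya0; apply: Ty; rewrite ya0.
have [f [[fc _] f0 f1 fP]] := arc_param D_dendrite ya0.
have cfT : closed (f @^-1` T) by apply: closed_comp => // x _; exact: fc.
have Tf1 : (f @^-1` T) 1 by rewrite /= f1.
have [m [/andP[m0 m1] Tm mP]] := first_hit cfT ler01 Tf1.
have {}m0 : 0 < m.
  by rewrite lt_neqAle m0 andbT; apply/eqP => m0'; apply: Ty; rewrite -f0 m0'.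
exists (f m); split => // a Ta; apply: contrapT => nya.
have : nbhs (f m) (~` arc y a).
  by apply: open_nbhs_nbhs; split => //; exact/closed_openC/arc_closed.
move=> /fc /nbhs_ballP[r r0 rP].
move: r0 => /= r0; have [w [w0 wr wm]] : exists w, [/\ 0 < w, w < r & w <= m].
  by exists (Num.min (r / 2) m); rewrite lt_min gt_min ge_min m0 lexx orbT divr_gt0 //; split => //;
    apply/orP; left; lra.
pose v := m - w.
have [v0 vm vr] : [/\ 0 <= v, v < m & ball m r v].
  by rewrite /ball /= ltr_norml /v; split; lra.
have nTv : ~ T (f v) by apply: mP; rewrite v0.
have arcv : arc y a0 (f v) by apply/fP; exists v => //; rewrite v0 /=; lra.
have [|aa0v] := arc_tri a arcv; first exact: rP.
by apply: nTv; exact: convT aa0v.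
Qed.

Lemma gate_uniq (T : set D) (y t t' : D) : gate T y t -> gate T y t' -> t = t'.
Proof. by move=> [Tt tP] [Tt' t'P]; apply: (@arc_antisym _ _ D_dendrite y); [exact: tP|exact: t'P]. Qed.

Definition retr (T : set D) (y : D) : D := xget y (gate T y).

Lemma retr_gate (T : set D) (y : D) : tree T -> gate T y (retr T y).
Proof. by move=> /(gate_exists y)[t yt]; exact: (xgetI y yt). Qed.

Lemma retr_in (T : set D) (y : D) : tree T -> T (retr T y).
Proof. by move=> /(retr_gate y)[]. Qed.

Lemma retr_arc (T : set D) (y a : D) : tree T -> T a -> arc y a (retr T y).
Proof. by move=> /(retr_gate y)[_]; apply. Qed.

Lemma retr_id (T : set D) (y : D) : tree T -> T y -> retr T y = y.
Proof. by move=> tT Ty; apply/arcxx; exact: retr_arc. Qed.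

Lemma retr_retr (S T : set D) (y : D) : tree S -> tree T -> S `<=` T ->
  retr S (retr T y) = retr S y.
Proof.
move=> tS tT ST; apply: (@gate_uniq S y); last exact: retr_gate.
split; first exact: retr_in.
move=> a Sa; apply/arc_sym.
apply: (arc_sub (z := retr T y)); first by apply/arc_sym; apply: retr_arc => //; exact: ST.
by apply/arc_sym; exact: retr_arc.
Qed.

(** This makes all retractions onto subtrees equicontinuous, because arcs between
    close points are small. *)
Lemma retr_near (T : set D) (y z : D) : tree T ->
  retr T y = retr T z \/ arc y z (retr T y) /\ arc y z (retr T z).
Proof.
move=> tT; set a := retr T y; set b := retr T z.
have Ta : T a by exact: retr_in.
have Tb : T b by exact: retr_in.
have yba : arc y b a by exact: retr_arc.
have zab : arc z a b by exact: retr_arc.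
have [yza|zba] := arc_tri z yba; last by left; exact: arc_antisym zba zab.
have [zyb|yab] := arc_tri y zab; last by left; exact: (arc_antisym D_dendrite yba yab).
by right; split => //; exact: arc_sym.
Qed.

Lemma retr_equicont (e : R) : 0 < e -> exists2 r, 0 < r & forall (T : set D) (y z : D),
  tree T -> mdist y z < r -> mdist (retr T y) (retr T z) < e.
Proof.
move=> e0; have [r r0 rP] := arc_small D_dendrite (divr_gt0 e0 (ltr0Sn R 1)).
exists r => // T y z tT yz; have [->|[h1 h2]] := retr_near y z tT; first by rewrite mdistxx.
have := rP _ _ _ yz h1; have := rP _ _ _ yz h2.
have := metric_triangle (retr T y) y (retr T z); rewrite (metric_sym (retr T y) y); lra.
Qed.

Lemma retr_cont (T : set D) : tree T -> continuous (retr T).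
Proof.
move=> tT; apply/cont_selfP => x e e0; have [r r0 rP] := retr_equicont e0.
by exists r => // y; exact: rP.
Qed.

Lemma tree_branch (T : set D) (e : D) : tree T -> tree (T `|` arc (retr T e) e).
Proof.
move=> tT; have [cT T0 convT] := tT; have Tx := retr_in e tT.
split.
- by apply: closedU => //; exact: arc_closed.
- by exists (retr T e); left.
have mix a b c : T a -> arc (retr T e) e b -> arc a b c -> (T `|` arc (retr T e) e) c.
  move=> Ta Ab /(arc_tri (retr T e))[xc|xc]; first by left; exact: convT xc.
  by right; exact: arc_sub xc.
move=> a b c [Ta|Aa] [Tb|Ab] abc.
- by left; exact: convT abc.
- exact: mix abc.
- by apply: mix (arc_sym abc).
- by right; exact: arc_convex abc.
Qed.

Lemma branch_meet (T : set D) (e y : D) : tree T -> T y -> arc (retr T e) e y -> y = retr T e.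
Proof.
move=> tT Ty xey; apply: (@arc_antisym _ _ D_dendrite e); first exact: arc_sym.
exact: retr_arc.
Qed.

Lemma retr_branch (T : set D) (e y : D) : tree T -> arc (retr T e) e y -> retr T y = retr T e.
Proof.
move=> tT xey; apply: branch_meet => //; first exact: retr_in.
have yx : arc y (retr T e) (retr T y) by apply: retr_arc => //; exact: retr_in.
by apply: (arc_convex D_dendrite xey _ yx); exact: arc_left.
Qed.

Lemma retr_off_branch (T : set D) (e y : D) : tree T -> T y ->
  retr (arc (retr T e) e) y = retr T e.
Proof.
move=> tT Ty; have tA := tree_arc (retr T e) e.
apply: branch_meet => //; last exact: retr_in.
have yx : arc y (retr T e) (retr (arc (retr T e) e) y) by apply: retr_arc => //; exact: arc_left.
by have [_ _ convT] := tT; apply: convT yx => //; exact: (retr_in e tT).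
Qed.

Definition endpoint (e : D) := forall a b, arc a b e -> e = a \/ e = b.

Lemma arcs_through_closed (x y : D) : closed [set z | arc x z y].
Proof.
move=> z zcl; apply: contrapT => /= xzy.
have zy : 0 < mdist z y by rewrite mdist_gt0; apply/eqP => zy; apply: xzy; rewrite zy; exact: arc_right.
have [r r0 rP] := arc_small D_dendrite zy.
have [z' [/= xz'y]] := zcl _ (nbhsx_ballx z r r0); rewrite ballEmdist /= => zz'.
have [//|zz'y] := arc_tri z xz'y.
by have := rP _ _ _ zz' zz'y; rewrite ltxx.
Qed.

(** A point e beyond q, as seen from x, with nothing further beyond it is an
    endpoint: an arc through e has e on one of the arcs that join x to its ends.
    Such a point exists since the sets of points beyond a given one are closed. *)
Lemma endpoint_exists (x q : D) : exists2 e, endpoint e & arc x e q.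
Proof.
pose S := {z : D | arc x z q}.
pose q0 : S := exist (fun z => arc x z q) q (@arc_right _ _ x q).
pose le_ (y z : S) := `[< arc x (sval z) (sval y) >].
have [||A Atot|[e xeq] emax] := @ZL_preorder S q0 le_.
- by move=> y; apply/asboolP; exact: arc_right.
- move=> a b c /asboolP ab /asboolP bc; apply/asboolP; exact: arc_sub ab.
- have [[a Aa]|A0] := pselect (A !=set0); last first.
    by exists q0 => s As; exfalso; apply: A0; exists s.
  pose F := filter_from A (fun y : S => [set z | arc x z (sval y)]).
  have FF : Filter F.
    apply: filter_from_filter; first by exists a.
    move=> b c Ab Ac; have [/asboolP bc|/asboolP cb] := Atot _ _ Ab Ac.
      by exists c => // z /= xzc; split => //=; exact: arc_sub bc.
    by exists b => // z /= xzb; split => //=; exact: arc_sub cb.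
  have PF : ProperFilter F.
    apply: filter_from_proper => b _; exists (sval b); exact: arc_right.
  have [[D_compact _ _] _ _] := D_dendrite.
  have [z [_ zF]] := D_compact F PF filterT.
  have zA b : A b -> arc x z (sval b).
    move=> Ab; apply: (@arcs_through_closed x (sval b)) => U Uz.
    by apply: zF => //; exists b.
  have xzq : arc x z q by apply: arc_sub (zA _ Aa) _; exact: svalP a.
  by exists (exist (fun z => arc x z q) z xzq) => s As; apply/asboolP; exact: zA.
exists e => // a b.
have key z : arc x z e -> e = z.
  move=> xze; have xzq : arc x z q by exact: arc_sub xze xeq.
  have /asboolP /= xez : le_ (exist (fun z => arc x z q) z xzq) (exist (fun z => arc x z q) e xeq) by apply: emax; apply/asboolP.
  exact: (arc_antisym D_dendrite xze xez).
by move=> /(arc_tri x)[/arc_sym/key|/key]; [left|right].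
Qed.

(** The arcs from e to a and to b both pass through the foot of the branch, and
    an endpoint could only be the last point of both. *)
Lemma branch_point_interior (T : set D) (e a b : D) : tree T -> ~ T e -> T a -> T b -> a <> b ->
  ~ endpoint (retr T e).
Proof.
move=> tT Te Ta Tb ab xend; have Tx := retr_in e tT.
have [xe|xa] := xend _ _ (retr_arc (y := e) tT Ta); first by apply: Te; rewrite -xe.
have [xe|xb] := xend _ _ (retr_arc (y := e) tT Tb); first by apply: Te; rewrite -xe.
by apply: ab; rewrite -xa -xb.
Qed.

End trees.

(** * Small folds of a real function *)

Section levels.
Context {R : realType} (f : R -> R).
Hypothesis f_cont : continuous f.

Lemma first_level (c d p : R) : c <= d -> f c <= p -> p <= f d ->
  exists m, [/\ c <= m <= d, f m = p & forall u, c <= u < m -> f u < p].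
Proof.
move=> cd cp pd; have [d1 /andP[cd1 d1d] fd1] := ivt f_cont cd cp pd.
have [m [/andP[cm md1] fm mP]] := first_hit (closed_level (p := p) f_cont) cd1 fd1.
exists m; split => //; first by rewrite cm (le_trans md1).
move=> u /andP[cu um]; rewrite ltNge; apply/negP => pu.
have [z /andP[cz zu] fz] := ivt f_cont cu cp pu.
by apply: (mP z) fz; rewrite cz (le_lt_trans zu).
Qed.

Lemma last_level (c d p : R) : c <= d -> f c <= p -> p <= f d ->
  exists m, [/\ c <= m <= d, f m = p & forall u, m < u <= d -> p < f u].
Proof.
move=> cd cp pd; have [c1 /andP[cc1 c1d] fc1] := ivt f_cont cd cp pd.
have [m [/andP[c1m md] fm mP]] := last_hit (closed_level (p := p) f_cont) c1d fc1.
exists m; split => //; first by rewrite md andbT (le_trans cc1).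
move=> u /andP[mu ud]; rewrite ltNge; apply/negP => up.
have [z /andP[uz zd] fz] := ivt f_cont ud up pd.
by apply: (mP z) fz; rewrite zd andbT (lt_le_trans mu).
Qed.

End levels.

Section folds.
Context {R : realType} (f : R -> R).
Hypothesis f_cont : continuous f.

Lemma betweenP (x y z : R) : x <= y -> between x y z -> x <= z <= y.
Proof. by move=> xy; rewrite /between min_l // max_r. Qed.

Lemma lt_time (u v : R) : u <= v -> f u <> f v -> u < v.
Proof. by rewrite le_eqVlt => /orP[/eqP->|]. Qed.

Lemma first_drop (c d p : R) : c <= d -> p <= f c -> f d <= p ->
  exists m, [/\ c <= m <= d, f m = p & forall u, c <= u < m -> p < f u].
Proof.
move=> cd cp pd.
have nf_cont : continuous (fun u => - f u) by move=> u; apply: cvgN; exact: f_cont.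
have [|||m [cmd /oppr_inj fm mP]] := @first_level R (fun u => - f u) nf_cont c d (- p) => //.
- by rewrite lerN2.
- by rewrite lerN2.
by exists m; split => // u /mP; rewrite ltrN2.
Qed.

Lemma shrink_crossing (c d p e : R) : c < d -> f c < p < f d -> 0 < e ->
  exists c' d', [/\ c <= c', c' < d', d' <= d, f c' < p < f d'
    & forall u, c' <= u <= d' -> `|f u - p| < e].
Proof.
move=> cd /andP[fc fd] e0.
have [q [q0 qe qc qd]] : exists q, [/\ 0 < q, q < e, q <= p - f c & q <= f d - p].
  exists (Num.min (e / 2) (Num.min (p - f c) (f d - p))).
  rewrite !lt_min !gt_min !ge_min !subr_gt0 fc fd divr_gt0 // !lexx !orbT; split => //.
  by apply/orP; left; lra.
have h1 : f c <= p + q by lra.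
have h2 : p + q <= f d by lra.
have [d' [/andP[cd' d'd] fd' d'P]] := first_level f_cont (ltW cd) h1 h2.
have h3 : f c <= p - q by lra.
have h4 : p - q <= f d' by lra.
have [c' [/andP[cc' c'd'] fc' c'P]] := last_level f_cont cd' h3 h4.
exists c', d'; split => //; [by apply: lt_time => //; rewrite fc' fd' => h; lra|lra|].
move=> u /andP[c'u ud'].
have fu1 : f u <= p + q.
  move: ud'; rewrite le_eqVlt => /orP[/eqP->|ud']; first by rewrite fd'.
  by apply/ltW/d'P; rewrite ud' (le_trans cc').
have fu2 : p - q <= f u.
  move: c'u; rewrite le_eqVlt => /orP[/eqP<-|c'u]; first by rewrite fc'.
  by apply/ltW/c'P; rewrite c'u.
by rewrite ltr_norml; lra.
Qed.

Hypothesis f_folds : small_folds f.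
Hypothesis f_unit : forall u, 0 <= u <= 1 -> 0 <= f u <= 1.

Lemma small_fold (q : R) : 0 < q -> exists b x, [/\ 0 < b, b < q, 0 < x, x < b / 4
  & forall a a', 0 <= a <= 1 -> 0 <= a' <= 1 -> `|a - a'| < b -> crooked f x a a'].
Proof.
move=> q0; have [|b [x [/andP[b0 bq] /andP[x0 xb] H]]] := f_folds (lambda := Num.min q 2^-1).
  by rewrite lt_min q0 gt_min invr_gt0 ltr0n /=; apply/orP; right; lra.
exists b, x; split => //; by move: bq; rewrite lt_min => /andP[].
Qed.

(** Crookedness is applied between lo, slightly more than x below p, and hi, more
    than x above p, where x is the tolerance: the first approach c' of hi lies
    above p, and the subsequent return v towards lo lies below p. The excursion is
    the component around c' of the times at which f exceeds p. The second time
    bound w is the first time at the level hi, so that f stays below f w before. *)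
Lemma excursion (c d p e : R) : 0 <= c -> c < d -> d <= 1 -> f c < p < f d -> 0 < e ->
  exists s t v w, [/\ c <= s, s < t, t < v, v < w & w <= d] /\
    [/\ f s = p, f t = p, forall u, s < u < t -> p < f u, f v < p & p < f w] /\
    ((forall u, s <= u <= t -> f u < f w) /\ f w <= p + e).
Proof.
move=> c0 cd d1 /andP[fc fd] e0.
have [q [q0 qe qc qd]] : exists q, [/\ 0 < q, q <= e, q <= p - f c & q <= f d - p].
  exists (Num.min e (Num.min (p - f c) (f d - p))).
  by rewrite !lt_min !ge_min !subr_gt0 fc fd e0 !lexx !orbT.
have [b [x [b0 bq x0 xb crk]]] := small_fold q0.
pose lo := p - x - b / 8; pose hi := lo + b * 7 / 8.
have /andP[fc0 fc1] : 0 <= f c <= 1 by apply: f_unit; lra.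
have /andP[fd0 fd1] : 0 <= f d <= 1 by apply: f_unit; lra.
have lo_c : f c < lo by rewrite /lo; lra.
have hi_d : hi < f d by rewrite /hi /lo; lra.
have lo_p : lo < p by rewrite /lo; lra.
have hi_p : p + x < hi by rewrite /hi /lo; lra.
have hi_e : hi <= p + e by rewrite /hi /lo; lra.
have crk' : crooked f x lo hi.
  apply: crk; [lra|lra|rewrite ltr_norml /hi; lra].
have hi_c : f c <= hi by rewrite ltW // (lt_trans fc) // (le_lt_trans _ hi_p) // lerDl ltW.
have [w [/andP[cw wd] fw wP]] := first_level f_cont (ltW cd) hi_c (ltW hi_d).
have lo_w : lo <= f w by rewrite fw ltW // (lt_trans lo_p) // (le_lt_trans _ hi_p) // lerDl ltW.
have [c1 /andP[cc1 c1w] fc1'] := ivt f_cont cw (ltW lo_c) lo_w.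
have c01 : unit_interval R c1 by apply/unit_intervalP; rewrite (le_trans c0) // (le_trans c1w) // (le_trans wd).
have w01 : unit_interval R w by apply/unit_intervalP; rewrite (le_trans c0) // (le_trans wd).
have [c' [v [b1 b2 hc' hv]]] := crk' c1 w c01 w01 fc1' fw.
have /andP[c1c' c'w] := betweenP c1w b1.
have /andP[c'v vw] := betweenP c'w b2.
have fc' : p < f c' by move: hc'; rewrite ler_norml; move: hi_p; clear; lra.
have fv : f v < p by move: hv; rewrite ler_norml /lo; move: b0; clear; lra.
have pw : p < f w by rewrite fw (le_lt_trans _ hi_p) // lerDl ltW.
have c1p : f c1 <= p by rewrite fc1' ltW.
have [s [/andP[c1s sc'] fs sP]] := last_level f_cont c1c' c1p (ltW fc').
have [t [/andP[c't tv] ft tP]] := first_drop c'v (ltW fc') (ltW fv).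
have neq a a' : f a < f a' -> f a <> f a' by move=> /[swap] ->; rewrite ltxx.
have tv' : t < v by apply: lt_time tv _; apply/nesym/neq; rewrite ft.
have vw' : v < w by apply: lt_time vw _; apply: neq; exact: lt_trans pw.
have sc'' : s < c' by apply: lt_time sc' _; apply: neq; rewrite fs.
have ct' : c' < t by apply: lt_time c't _; apply/nesym/neq; rewrite ft.
exists s, t, v, w; split; [split => //|split; [split => //|]].
- by rewrite (le_trans cc1).
- exact: lt_trans ct'.
- move=> u /andP[su ut]; have [uc'|c'u] := leP u c'; first by apply: sP; rewrite su.
  by apply: tP; rewrite ut ltW.
- split; last by rewrite fw.
  move=> u /andP[su ut]; rewrite fw; apply: wP.
  by rewrite (le_trans (le_trans cc1 c1s)) // (le_lt_trans ut) // (lt_trans tv').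
Qed.

(** A decreasing passage through p folds, and the fold contains an increasing
    one. *)
Lemma increasing_crossing (p : R) : (exists2 u, 0 <= u <= 1 & f u = 0) ->
  (exists2 u, 0 <= u <= 1 & f u = 1) -> 0 < p < 1 ->
  exists c d, [/\ 0 <= c, c < d, d <= 1 & f c < p < f d].
Proof.
move=> [c0 /andP[c00 c01] fc0] [d0 /andP[d00 d01] fd0] /andP[p0 p1].
have [cd|dc] := leP c0 d0.
  exists c0, d0; rewrite fc0 fd0 p0 p1; split => //; apply: lt_time => //; rewrite fc0 fd0; lra.
have [q [q0 qp qp1]] : exists q, [/\ 0 < q, q <= p & q <= 1 - p].
  exists (Num.min p (1 - p)); rewrite !lt_min !ge_min !subr_gt0 p0 p1 !lexx !orbT; split => //.
have [b [x [b0 bq x0 xb crk]]] := small_fold q0.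
pose hi := p + b * 3 / 8; pose lo := p - b * 3 / 8.
have crk' : crooked f x hi lo.
  apply: crk; rewrite /hi /lo; [lra|lra|rewrite ltr_norml; lra].
have hi_d : hi <= f d0 by rewrite /hi; lra.
have hi_c : f c0 <= hi by rewrite /hi; lra.
have [h [/andP[dh hc] fh _]] := first_drop (ltW dc) hi_d hi_c.
have lo_h : lo <= f h by rewrite fh /lo /hi; lra.
have lo_c : f c0 <= lo by rewrite /lo; lra.
have [l [/andP[hl lc] fl _]] := first_drop hc lo_h lo_c.
have [|||//|c [d [b1 b2 hc' hd]]] := crk' h l; [apply/unit_intervalP; lra|apply/unit_intervalP; lra|by []|].
have /andP[hc1 c1l] := betweenP hl b1.
have /andP[cd dl] := betweenP c1l b2.
have fc : f c < p by move: hc'; rewrite ler_norml /lo; lra.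
have fd : p < f d by move: hd; rewrite ler_norml /hi; lra.
exists c, d; split; [lra| |lra|lra].
by apply: lt_time => //; lra.
Qed.

End folds.

(** * Attaching a branch *)

Section growing.
Context {R : realType} (D : metricType R) (f : R -> R).
Hypothesis D_dendrite : is_dendrite D.
Hypothesis f_cont : continuous f.
Hypothesis f_folds : small_folds f.
Hypothesis f_unit : forall u, 0 <= u <= 1 -> 0 <= f u <= 1.

(** The inverse kap of the parameter phi is extended to D by the retraction onto
    the arc. *)
Lemma branch_coordinate (x e : D) : x <> e -> exists (phi : R -> D) (kap : D -> R),
  [/\ continuous phi, phi 0 = x, forall z, arc x e z <-> exists2 u, 0 <= u <= 1 & phi u = z
    & phi 1 = e] /\
  [/\ continuous kap, forall u, 0 <= u <= 1 -> kap (phi u) = u, forall y, 0 <= kap y <= 1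
    & forall y, kap (retr (arc x e) y) = kap y].
Proof.
move=> xe; have [phi [[pc pinj] p0 p1 pP]] := arc_param D_dendrite xe.
have [k [kp kc]] := injective_path_inverse (conj pc pinj).
have tA := tree_arc D_dendrite x e.
exists phi, (k \o retr (arc x e)); split => //; split.
- apply/cont_funP => y d d0.
  have /pP[u u01 pu] := retr_in D_dendrite y tA.
  have [r r0 rP] := kc u d u01 d0.
  have /cont_selfP/(_ y r r0)[q q0 qP] := retr_cont D_dendrite tA.
  exists q => // z /qP yz /=.
  have /pP[v v01 pv] := retr_in D_dendrite z tA.
  by rewrite -pu -pv; apply: rP => //; rewrite pu pv.
- move=> u u01 /=; rewrite retr_id ?kp //; apply/pP; by exists u.
- by move=> y /=; have /pP[u u01 <-] := retr_in D_dendrite y tA; rewrite kp.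
- by move=> y /=; congr k; apply: retr_id => //; exact: retr_in.
Qed.

(** On the time interval [c, d] the path g factors through f, that is, it moves
    along an arc on which h is injective, and it goes through x upwards. *)
Definition crossing (g : R -> D) (p : R) (x : D) := exists c d,
  [/\ 0 <= c, c < d, d <= 1, f c < p < f d & exists2 u, c <= u <= d & g u = x] /\
  forall u v, c <= u <= d -> c <= v <= d -> f u = f v -> g u = g v.

(** The condition [stage_retr] says that h is constant on the parts of D cut off
    by T. *)
Record stage (T : set D) (g : R -> D) (h : D -> R) : Prop := Stage {
  stage_tree : tree T;
  stage_two : exists a b, [/\ T a, T b & a <> b];
  stage_gc : continuous g;
  stage_hc : continuous h;
  stage_into : forall u, 0 <= u <= 1 -> T (g u);
  stage_onto : forall y, T y -> exists2 u, 0 <= u <= 1 & g u = y;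
  stage_retr : forall y, h (retr T y) = h y;
  stage_factor : forall u, 0 <= u <= 1 -> h (g u) = f u;
  stage_crossing : forall x, T x -> ~ endpoint x -> crossing g (h x) x }.

Lemma itv_sub (a b c d u : R) : a <= c -> d <= b -> c <= u <= d -> a <= u <= b.
Proof. by move=> ac db /andP[cu ud]; rewrite (le_trans ac cu) (le_trans ud db). Qed.

Lemma itv_avoid (s t c d : R) : ~ (c <= s <= d) -> ~ (c <= t <= d) ->
  (forall u, c <= u <= d -> ~ (s < u < t)) \/ (s < c /\ d < t).
Proof.
move=> ns nt; have [sc|cs] := ltP s c; last first.
  left=> u /andP[cu ud] /andP[su _]; apply: ns.
  by rewrite cs ltW // (lt_le_trans su).
have [dt|td] := ltP d t; first by right.
left=> u /andP[cu ud] /andP[_ ut]; apply: nt.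
by rewrite td ltW // (le_lt_trans cu).
Qed.

Lemma open_itv_dec (s t u : R) : s <= u <= t \/ ~ (s < u < t).
Proof.
have [su|su] := leP s u; last by right=> /andP[/(lt_trans su)]; rewrite ltxx.
by have [ut|ut] := leP u t; [left|right=> /andP[_ /(lt_trans ut)]; rewrite ltxx].
Qed.

Lemma ivt_between (a b p : R) : a <= b -> f a < p < f b ->
  exists2 u, a <= u <= b & f u = p.
Proof. by move=> ab /andP[pa pb]; exact: ivt f_cont ab (ltW pa) (ltW pb). Qed.

(** New crossings: at the foot x, the climb from v to w. On the branch, the
    ascending half of the excursion. At any other point z of T an old crossing
    still works once it is shortened so as to avoid the excursion [s, t]; this
    fails only when z is visited just during the excursion, and then the climb
    from v to w goes through z. *)
Lemma grow (T : set D) (g : R -> D) (h : D -> R) (e : D) (eps : R) :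
  stage T g h -> endpoint e -> ~ T e -> 0 < eps ->
  exists T' g' h', [/\ stage T' g' h', T `<=` T', T' e & forall y, T y -> h' y = h y] /\
    (forall y, `|h' y - h y| <= eps) /\
    forall S u, tree S -> S `<=` T -> 0 <= u <= 1 ->
      mdist (retr S (g' u)) (retr S (g u)) < eps.
Proof.
move=> [tT [a0 [b0 [Ta0 Tb0 ab0]]] gc hc gT gonto hT hg gcross] eend Te eps0.
pose x := retr T e; pose A := arc x e; pose p := h x.
have Tx : T x by exact: retr_in.
have xend : ~ endpoint x by exact: branch_point_interior Ta0 Tb0 ab0.
have xe : x <> e by move=> xe; apply: Te; rewrite -xe.
have [phi [kap [[pc p0 pA p1] [kc kphi k01 kA]]]] := branch_coordinate xe.
have tA : tree A by exact: tree_arc.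
have tTA : tree (T `|` A) by exact: tree_branch.
have [c [d [[c0 cd d1 fcd [u0 u0cd gu0]] ginj]]] := gcross x Tx xend.
rewrite -/p in fcd.
have in01 u : c <= u <= d -> 0 <= u <= 1.
  by apply: itv_sub => //; exact: ltW.
have fu0 : f u0 = p by rewrite -hg ?gu0 //; exact: in01.
have atx u : c <= u <= d -> f u = p -> g u = x.
  by move=> ucd fu; rewrite -gu0; apply: ginj => //; rewrite fu.
have [dl dl0 dlP] := retr_equicont D_dendrite eps0.
have [|r r0 rP] := @factor_cont R R^o D f g c d u0 f_cont gc u0cd _ dl dl0.
  by move=> u ucd; exact: ginj.
have [q [q0 qe qr]] : exists q, [/\ 0 < q, q <= eps & q < r].
  exists (Num.min eps (r / 2)); rewrite lt_min ge_min gt_min eps0 lexx divr_gt0 //.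
  by split => //; apply/orP; right; lra.
have [s [t [v [w [[cs st tv vw wd] [[fs ft fst fv fw] [fmax fwq]]]]]]] :=
  excursion f_cont f_folds f_unit c0 cd d1 fcd q0.
have sd : s <= d by apply: le_trans wd; rewrite !ltW // (lt_trans st) // (lt_trans tv).
have ct : c <= t by rewrite (le_trans cs) // ltW.
have td : t <= d by apply: le_trans wd; rewrite ltW // (lt_trans tv).
have scd : c <= s <= d by rewrite cs.
have tcd : c <= t <= d by rewrite ct.
have vd : v <= d by apply: le_trans wd; exact: ltW.
have gs : g s = x by exact: atx.
have gt : g t = x by exact: atx.
have vwcd u : v <= u <= w -> c <= u <= d.
  by apply: itv_sub => //; rewrite (le_trans ct) // ltW.
have stcd u : s <= u <= t -> c <= u <= d by exact: itv_sub.
have st01 u : s <= u <= t -> 0 <= u <= 1 by move=> /stcd /in01.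
have fge u : s <= u <= t -> p <= f u.
  move=> /andP[su ut]; have [su'|su'] := eqVneq s u; first by rewrite -su' fs.
  have [ut'|ut'] := eqVneq u t; first by rewrite ut' ft.
  by apply/ltW/fst; rewrite !lt_neqAle su' su ut' ut.
have [|m + mmax] := @EVT_max R f s t (ltW st); first exact: continuous_subspaceT.
rewrite in_itv /= => mst; pose M := f m.
have fM u : s <= u <= t -> f u <= M by move=> ust; apply: mmax; rewrite in_itv.
have pM : p < M.
  have [sm tm] := midf_lt st.
  by apply: (@lt_le_trans _ _ (f ((s + t) / 2))); [apply: fst; rewrite sm|apply: fM; rewrite !ltW].
have Mw : M < f w by exact: fmax.
pose l := M - p; have l0 : 0 < l by rewrite subr_gt0.
have leps : l <= eps.
  by apply: le_trans qe; rewrite lerBlDl ltW // (lt_le_trans Mw).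
pose co u := (f u - p) / l.
have co01 u : s <= u <= t -> 0 <= co u <= 1.
  move=> ust; rewrite /co divr_ge0 ?(ltW l0) ?subr_ge0 ?fge //= ler_pdivrMr // mul1r.
  by rewrite lerB // fM.
pose beta u := phi (co u).
have beta_cont : continuous beta.
  rewrite (_ : beta = (fun u => phi (l^-1 * u + (- p / l))) \o f); last first.
    by apply/funext => u; rewrite /beta /co /=; congr phi; rewrite mulrBl mulrC mulNr.
  by move=> u; apply: continuous_comp; [exact: f_cont|exact: reparam_cont].
have beta_s : beta s = x by rewrite /beta /co fs subrr mul0r.
have beta_t : beta t = x by rewrite /beta /co ft subrr mul0r.
pose inner u := if u <= t then beta u else g u.
pose g' u := if u <= s then g u else inner u.
have g'c : continuous g'.
  apply: glue_cont => //; last by rewrite /inner (ltW st) beta_s.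
  by apply: glue_cont => //; rewrite beta_t.
have g'in u : s <= u <= t -> g' u = beta u.
  move=> /andP[su ut]; rewrite /g' /inner ut; case: ifP => // us.
  have -> : u = s by apply/eqP; rewrite eq_le us.
  by rewrite gs beta_s.
have g'out u : ~ (s < u < t) -> g' u = g u.
  rewrite /g' /inner; case: (leP u s) => // su; case: (leP u t) => // ut nst.
  have -> : u = t by apply/eqP; rewrite eq_le ut leNgt; apply/negP => ut'; apply: nst.
  by rewrite gt beta_t.
(* at the times s and t both descriptions of g' apply *)
have g'case := open_itv_dec s t.
have betaA u : s <= u <= t -> A (beta u) by move=> ust; apply/pA; exists (co u) => //; exact: co01.
pose h' y := h y + l * kap y.
have kapT y : T y -> kap y = 0.
  move=> Ty; rewrite -kA /A retr_off_branch //.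
  by rewrite -/x -p0 kphi // lexx ler01.
have h'T y : T y -> h' y = h y by move=> /kapT ky; rewrite /h' ky mulr0 addr0.
have h'phi z : 0 <= z <= 1 -> h' (phi z) = p + l * z.
  move=> z01; rewrite /h' kphi //; congr (_ + _).
  by rewrite -hT (@retr_branch _ _ D_dendrite T e) //; apply/pA; exists z.
have h'beta u : s <= u <= t -> h' (beta u) = f u.
  move=> ust; rewrite /beta h'phi; last exact: co01.
  by rewrite /co mulrC divfK ?gt_eqF // addrC subrK.
have recross (u : R) (z : D) : s < u < t -> g u = z -> f v < f u < f w /\
    exists2 u', v <= u' <= w & g u' = z.
  move=> /andP[su ut] gu; have ust : s <= u <= t by rewrite !ltW.
  have fu := fst u (introT andP (conj su ut)); have fuM := fM u ust.
  have fuw : f v < f u < f w by rewrite (lt_trans fv fu) (le_lt_trans fuM Mw).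
  split => //; have [u' u'vw fu'] := ivt_between (ltW vw) fuw.
  by exists u' => //; rewrite -gu; apply: ginj => //; [exact: vwcd|exact: stcd].
have vwout u : v <= u <= w -> ~ (s < u < t).
  by move=> /andP[vu _] /andP[_ ut]; have := lt_le_trans (lt_trans ut tv) vu; rewrite ltxx.
have vwcross z : f v < h z < f w -> (exists2 u, v <= u <= w & g u = z) -> T z ->
    crossing g' (h' z) z.
  move=> hz [u uvw gu] Tz; exists v, w; split; first split => //.
  - by rewrite (le_trans c0) // (le_trans ct) // ltW.
  - exact: le_trans d1.
  - by rewrite h'T.
  - by exists u => //; rewrite g'out //; exact: vwout.
  - move=> u1 u2 h1 h2 f12; rewrite !g'out; [|exact: vwout|exact: vwout].
    by apply: ginj => //; exact: vwcd.
exists (T `|` A), g', h'; split; [split|split] => //.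
- split => //.
  + by exists a0, b0; split => //; left.
  + move=> y; apply: cvgD; first exact: hc.
    by apply: cvgM; [exact: cvg_cst|exact: kc].
  + move=> u u01; have [ust|ust] := g'case u; first by right; rewrite g'in //; exact: betaA.
    by left; rewrite g'out //; exact: gT.
  + move=> y [Ty|/pA[z z01 phiz]].
      have [u u01 gu] := gonto y Ty; have [ust|ust] := pselect (s < u < t); last first.
        by exists u => //; rewrite g'out.
      have [_ [u' u'vw gu']] := recross u y ust gu; exists u'; first by apply/in01/vwcd.
      by rewrite g'out //; exact: vwout.
    have /andP[sm mt] := mst.
    have /andP[z0 z1] := z01.
    have [||u /andP[su um] fu] := @ivt R f s m (p + l * z) f_cont sm.
    - by rewrite fs lerDl mulr_ge0 // ltW.
    - by rewrite -/M -lerBrDl ger_pMr.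
    have ust : s <= u <= t by rewrite su (le_trans um).
    exists u; first exact: st01.
    rewrite g'in // /beta /co fu -phiz; congr phi.
    by rewrite addrC addKr mulrC mulKf // gt_eqF.
  + move=> y; rewrite /h'; congr (_ + _ * _).
      by rewrite -[RHS]hT -(hT (retr _ _)) retr_retr // => z; left.
    by rewrite -[RHS]kA -(kA (retr _ _)) retr_retr // => z; right.
  + move=> u u01; have [ust|ust] := g'case u; first by rewrite g'in // h'beta.
    by rewrite g'out // h'T ?hg //; exact: gT.
  + move=> z zTA zend; have [Tz|nTz] := pselect (T z); last first.
      case: zTA => [//|/pA[y y01 phiy]].
      have [y0 y1] : 0 < y /\ y < 1.
        move: y01 => /andP[y0 y1]; rewrite !lt_neqAle y0 y1 !andbT; split; apply/eqP => yy.
          by apply: nTz; rewrite -phiy -yy p0.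
        by apply: zend; rewrite -phiy yy p1.
      have hz : h' z = p + l * y by rewrite -phiy h'phi.
      have /andP[sm mt] := mst.
      have fz : f s < h' z < f m.
        by rewrite hz fs -/M ltrDl mulr_gt0 //= -ltrBrDl gtr_pMr.
      have sm' : s < m.
        have /andP[fz1 fz2] := fz; apply: lt_time => //; apply/eqP; rewrite lt_eqF //; exact: lt_trans fz2.
      have sub u : s <= u <= m -> s <= u <= t by move=> /andP[-> um]; rewrite (le_trans um).
      exists s, m; split; first split => //.
      * by have /in01/andP[] := scd.
      * by have /st01/andP[] := mst.
      * have [u usm fu] := ivt_between sm fz; exists u => //.
        rewrite g'in ?sub // /beta /co fu -phiy h'phi //; congr phi.
        by rewrite addrC addKr mulrC mulKf // gt_eqF.
      * by move=> u1 u2 h1 h2 f12; rewrite !g'in ?sub // /beta /co f12.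
    (* z in T at the level of the foot: h is injective along an old crossing of
       z <> x, which hence misses x, the position at the times s and t *)
    have [hzp|hzp] := eqVneq (h z) p.
      have [->|zx] := eqVneq z x.
        apply: vwcross => //; first by rewrite -/p fv fw.
        have fvw : f v < p < f w by rewrite fv fw.
        have [u uvw fu] := ivt_between (ltW vw) fvw.
        by exists u => //; apply: atx => //; exact: vwcd.
      have [c' [d' [[c'0 cd' d'1 fcd' [u1 u1cd gu1]] ginj']]] := gcross z Tz zend.
      rewrite hzp in fcd'.
      have fu1 : f u1 = p by rewrite -hzp -gu1 hg //; exact: (itv_sub c'0 d'1).
      have nx u : c' <= u <= d' -> f u = p -> g u <> x.
        move=> ucd fu gux; move/eqP: zx; apply; rewrite -gux -gu1; apply: ginj' => //.
        by rewrite fu.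
      have ns : ~ (c' <= s <= d') by move=> /nx; apply.
      have nt : ~ (c' <= t <= d') by move=> /nx; apply.
      have [out|[sc' dt']] := itv_avoid ns nt; last first.
        have /andP[fc' _] := fcd'.
        have := fst c'; rewrite sc' (lt_trans cd' dt') => /(_ isT) pc'.
        by have := lt_trans pc' fc'; rewrite ltxx.
      exists c', d'; split; first split => //.
      * by rewrite h'T // hzp.
      * by exists u1 => //; rewrite g'out //; exact: out.
      * by move=> u2 u3 h2 h3 f23; rewrite !g'out; [exact: ginj'|exact: out|exact: out].
    (* z in T at another level: a short crossing misses the level p of s and t *)
    have [c1 [d1' [[c10 cd1 d11 fcd1 [u1 u1cd gu1]] ginj1]]] := gcross z Tz zend.
    have pz0 : 0 < `|p - h z| by rewrite normr_gt0 subr_eq0 eq_sym.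
    have [c' [d' [cc' cd' dd' fcd' fnear]]] := shrink_crossing f_cont cd1 fcd1 pz0.
    have sub u : c' <= u <= d' -> c1 <= u <= d1' by exact: itv_sub.
    have in01' u : c1 <= u <= d1' -> 0 <= u <= 1 by exact: itv_sub.
    have [u2 u2cd fu2] := ivt_between (ltW cd') fcd'.
    have fu1 : f u1 = h z by rewrite -gu1 hg //; exact: in01'.
    have gu2 : g u2 = z by rewrite -gu1; apply: ginj1 => //; [exact: sub|rewrite fu2].
    have np u : c' <= u <= d' -> f u <> p.
      by move=> /fnear + fup; rewrite fup ltxx.
    have [u2st|u2st] := pselect (s < u2 < t).
      have [fvw ex] := recross u2 z u2st gu2; apply: vwcross => //.
      by rewrite -fu2.
    have ns : ~ (c' <= s <= d') by move=> /np; apply.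
    have nt : ~ (c' <= t <= d') by move=> /np; apply.
    have [out|[sc' dt']] := itv_avoid ns nt; last first.
      have /andP[cu2 u2d] := u2cd.
      by case: u2st; rewrite (lt_le_trans sc' cu2) (le_lt_trans u2d dt').
    exists c', d'; split; first split => //.
    * exact: le_trans cc'.
    * exact: le_trans d11.
    * by rewrite h'T.
    * by exists u2 => //; rewrite g'out //; exact: out.
    * move=> u3 u4 h3 h4 f34; rewrite !g'out; [|exact: out|exact: out].
      by apply: ginj1 => //; exact: sub.
- right; exact: arc_right.
- move=> y; rewrite /h' addrC addKr; have /andP[k0 k1] := k01 y.
  rewrite ger0_norm ?mulr_ge0 ?(ltW l0) //; apply: le_trans leps.
  by rewrite ler_piMr // ltW.
- move=> S u tS ST u01; have [ust|ust] := g'case u; last by rewrite g'out // mdistxx.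
  rewrite g'in // -(retr_retr D_dendrite (beta u) tS tT ST) (@retr_branch _ _ D_dendrite T e) //; last exact: betaA.
  apply: dlP => //; rewrite -/x -gu0; apply: rP; first exact: stcd.
  rewrite /mdist /= fu0 ger0_norm ?subr_ge0 ?fge //.
  apply: le_lt_trans qr; rewrite lerBlDl; apply: le_trans fwq; apply: ltW.
  exact: le_lt_trans (fM u ust) Mw.
Qed.

End growing.

(** * The limit *)

Section dense.
Context {R : realType} (D : metricType R).

(** The finite 2^-n-nets, for all n, listed in one sequence. *)
Lemma dense_sequence (y0 : D) : compact [set: D] ->
  exists q : nat -> D, forall y e, 0 < e -> exists n, mdist (q n) y < e.
Proof.
move=> cD.
have h0 n : (0 : R) < 2^-1 ^+ n by rewrite exprn_gt0 // invr_gt0.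
have /choice[s sP] : forall n, exists s : seq D, forall y, exists2 x, x \in s & mdist x y < 2^-1 ^+ n.
  move=> n; pose F := filter_from [set: seq D] (fun s => [set t : seq D | {subset s <= t}]).
  have FF : Filter F.
    apply: filter_from_filter; first by exists [::].
    move=> s t _ _; exists (s ++ t) => // u /= sub; split => z zs; apply: sub.
      by rewrite mem_cat zs.
    by rewrite mem_cat zs orbT.
  have /compact_near_coveringP cov := cD.
  have [|s _ sP] := cov _ F (fun s y => exists2 x, x \in s & mdist x y < 2^-1 ^+ n) FF.
    move=> y _; exists ([set z | mdist y z < 2^-1 ^+ n], [set t : seq D | {subset [:: y] <= t}]) => /=.
      by split; [apply/nbhs_distP; exists (2^-1 ^+ n)|exists [:: y]].
    by move=> [z t] /= [yz yt]; exists y => //; apply: yt; rewrite mem_seq1.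
  by exists s => y; apply: (sP s).
exists (fun m => if unpickle m is Some (n, i) then nth y0 (s n) i else y0) => y e e0.
have [N NP] := geom_small e0; have [x /(nthP y0)[i _ <-] xy] := sP N y.
exists (pickle (N, i)); rewrite pickleK; exact: lt_trans xy (NP N (leqnn _)).
Qed.

End dense.

Section factorization.
Context {R : realType} (D : metricType R) (f : R -> R).
Hypothesis D_dendrite : is_dendrite D.
Hypothesis f_cont : continuous f.
Hypothesis f_folds : small_folds f.
Hypothesis f_unit : forall u, 0 <= u <= 1 -> 0 <= f u <= 1.
Hypothesis f_onto : forall v, 0 <= v <= 1 -> exists2 u, 0 <= u <= 1 & f u = v.

Lemma first_stage (x e : D) : x <> e -> endpoint x -> endpoint e ->
  exists T g h, stage f T g h /\ T x.
Proof.
move=> xe xend eend.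
have [phi [kap [[pc p0 pA p1] [kc kphi k01 kA]]]] := branch_coordinate D_dendrite xe.
exists (arc x e), (phi \o f), kap; split; last exact: arc_left.
split => //.
- exact: tree_arc.
- by exists x, e; split => //; [exact: arc_left|exact: arc_right].
- by move=> u; apply: continuous_comp; [exact: f_cont|exact: pc].
- by move=> u u01; apply/pA; exists (f u) => //; exact: f_unit.
- by move=> y /pA[v v01 <-]; have [u u01 <-] := f_onto v01; exists u.
- by move=> u u01 /=; rewrite kphi //; exact: f_unit.
- move=> z /pA[y y01 phiy] zend.
  have y01' : 0 < y < 1.
    move: y01 => /andP[y0 y1]; rewrite !lt_neqAle y0 y1 !andbT; apply/andP; split; apply/eqP => yy.
      by apply: zend; rewrite -phiy -yy p0.
    by apply: zend; rewrite -phiy yy p1.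
  have [|||c [d [c0 cd d1 fcd]]] := @increasing_crossing R f f_cont f_folds y.
  - by apply: f_onto; rewrite lexx ler01.
  - by apply: f_onto; rewrite lexx ler01.
  - exact: y01'.
  exists c, d; split; first split => //.
  - by rewrite -phiy kphi.
  - have [u ucd fu] := ivt_between f_cont (ltW cd) fcd.
    by exists u => //=; rewrite fu.
  - by move=> u v _ _ /= ->.
Qed.

(** The last clause bounds how far g moves only through the trees inside the old
    one, since the new branch may be long. *)
Definition refines (n : nat) (e : D) (s s' : set D * (R -> D) * (D -> R)) :=
  [/\ s.1.1 `<=` s'.1.1, s'.1.1 e, forall y, s.1.1 y -> s'.2 y = s.2 y,
      forall y, `|s'.2 y - s.2 y| <= 2^-1 ^+ n
    & forall S u, tree S -> S `<=` s.1.1 -> 0 <= u <= 1 ->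
      mdist (retr S (s'.1.2 u)) (retr S (s.1.2 u)) <= 2^-1 ^+ n].

Lemma stages (x : D) (e : nat -> D) : endpoint x -> (forall n, endpoint (e n)) -> x <> e 0%N ->
  exists s : nat -> set D * (R -> D) * (D -> R), (s 0%N).1.1 x /\ forall n,
    stage f (s n).1.1 (s n).1.2 (s n).2 /\ refines n (e n) (s n) (s n.+1).
Proof.
move=> xend eend xe.
have [T [g [h [st Tx]]]] := first_stage xe xend (eend 0%N).
have h0 n : (0 : R) < 2^-1 ^+ n by rewrite exprn_gt0 // invr_gt0.
have [||s [s0 sP]] := @dep_choice (set D * (R -> D) * (D -> R))
  (fun n s => stage f s.1.1 s.1.2 s.2) (fun n s s' => refines n (e n) s s') (T, g, h).
- by [].
- move=> n s ss; have [Te|Te] := pselect (s.1.1 (e n)).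
    exists s => //; split => //; first by move=> y; rewrite subrr normr0 ltW.
    by move=> S u _ _ _; rewrite mdistxx ltW.
  have [T' [g' [h' [[st' TT' T'e hh'] [heps geps]]]]] :=
    grow D_dendrite f_cont f_folds f_unit ss (eend n) Te (h0 n).
  exists (T', g', h') => //; split => // S u tS ST u01; apply: ltW; exact: geps.
by exists s; split; [rewrite s0|exact: sP].
Qed.

Theorem dendrite_factorization : exists (g : R -> D) (h : D -> R),
  [/\ continuous g, continuous h, forall y, exists2 u, 0 <= u <= 1 & g u = y,
      forall u, 0 <= u <= 1 -> h (g u) = f u
    & forall U : set D, open U -> U !=set0 -> exists a b p, a < p < b /\
        forall v, a <= v <= b -> (h @` U) v].
Proof.
have [[D_compact _ [b1 [b2 b12]]] D_lc _] := D_dendrite.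
have [x xend _] := endpoint_exists D_dendrite b1 b1.
have [q0 q0x] : exists q0, q0 <> x.
  by have [b1x|] := pselect (b1 = x); [exists b2; rewrite -b1x; exact: nesym|exists b1].
have [q qdense] := dense_sequence b1 D_compact.
have /choice[e eP] : forall n, exists e, endpoint e /\ arc x e (if n is m.+1 then q m else q0).
  by move=> n; have [e ? ?] := endpoint_exists D_dendrite x (if n is m.+1 then q m else q0); exists e.
have xe : x <> e 0%N.
  move=> xe; have [_] := eP 0%N; rewrite -xe => /arcxx; exact: q0x.
have [s [sx sP]] := stages xend (fun n => proj1 (eP n)) xe.
pose T n := (s n).1.1; pose G n u := (s n).1.2 (clamp u); pose H n := (s n).2.
have st n : stage f (T n) (s n).1.2 (H n) by case: (sP n).
have tT n : tree (T n) by exact: stage_tree (st n).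
have Tmono n m : (n <= m)%N -> T n `<=` T m.
  move=> nm; rewrite -(subnKC nm); elim: (m - n)%N => [|k IH]; first by rewrite addn0.
  rewrite addnS; apply: subset_trans IH _; by case: (sP (n + k)%N) => _ [].
have Tx n : T n x by apply: (Tmono 0%N).
have Tq n m : (n.+1 < m)%N -> T m (q n).
  move=> nm; have Te : T m (e n.+1) by apply: (Tmono n.+2) => //; case: (sP n.+1) => _ [].
  have [_ _ convT] := tT m; apply: (convT x (e n.+1)) => //.
  by have [] := eP n.+1.
(* y is close to some q k, and the small arc from y to q k enters a late tree *)
have Tdense d : 0 < d -> exists N, forall n y, (N <= n)%N -> mdist y (retr (T n) y) < d.
  move=> d0; have [r r0 rP] := arc_small D_dendrite d0.
  have /compact_near_coveringP cov := D_compact.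
  have [|N _ NP] := cov nat (nbhs \oo) (fun n y => mdist y (retr (T n) y) < d) _.
    move=> y _; have r2 : 0 < r / 2 by rewrite divr_gt0.
    have [k qky] := qdense y _ r2.
    exists ([set z | mdist y z < r / 2], [set n | (k.+2 <= n)%N]) => /=.
      by split; [apply/nbhs_distP; exists (r / 2)|exists k.+2].
    move=> [z n] /= [yz kn]; apply: (rP z (q k)).
      have := metric_triangle z y (q k).
      rewrite (metric_sym z y) (metric_sym y (q k)); lra.
    by apply: retr_arc => //; exact: Tq.
  by exists N => n y Nn; exact: (NP n Nn).
have Gc n : continuous (G n).
  apply: (@within_clamp_cont _ _ (s n).1.2); apply: continuous_subspaceT.
  exact: stage_gc (st n).
have Grefine j n u : (j <= n)%N -> mdist (retr (T j) (G n u)) (G j u) <= 2 * 2^-1 ^+ j.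
  move=> jn.
  have step k v : mdist (retr (T j) (G (j + k)%N v)) (retr (T j) (G (j + k.+1)%N v)) <= 2^-1 ^+ j * 2^-1 ^+ k.
    rewrite metric_sym -exprD addnS; case: (sP (j + k)%N) => _ [_ _ _ _]; apply => //.
      by apply: Tmono; exact: leq_addr.
    exact: clamp_itv.
  have := geom_cauchy step u (leq0n (n - j)).
  rewrite addn0 subnKC // expr0 mulr1 (@retr_id _ _ D_dendrite _ (G j u)) //; last first.
    exact: (stage_into (st j) (clamp_itv u)).
  by rewrite metric_sym.
have [g gP] : exists g, forall d, 0 < d -> exists N, forall n u, (N <= n)%N -> mdist (G n u) (g u) < d.
  apply: uniform_limit; first exact: compact_seq_complete.
  move=> d d0; have d4 : 0 < d / 4 by rewrite divr_gt0.
  have [N1 N1P] := Tdense _ d4.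
  have d8 : 0 < d / 8 by rewrite divr_gt0.
  have [N2 N2P] := geom_small d8.
  pose j := maxn N1 N2; have j1 := N1P j _ (leq_maxl _ _); have j2 := N2P j (leq_maxr _ _).
  have close n u : (j <= n)%N -> mdist (G n u) (G j u) < d / 2.
    move=> jn; have := metric_triangle (G n u) (retr (T j) (G n u)) (G j u).
    have := j1 (G n u); have := Grefine j n u jn; lra.
  exists j => m n u jm jn; have := close m u jm; have := close n u jn.
  have := metric_triangle (G m u) (G j u) (G n u); rewrite (metric_sym (G j u) (G n u)); lra.
have [h hP] : exists h : D -> R^o, forall d, 0 < d -> exists N, forall n y, (N <= n)%N ->
    mdist (H n y : R^o) (h y) < d.
  apply: uniform_limit; first exact: real_seq_complete.
  have step n y : mdist (H n y : R^o) (H n.+1 y) <= 1 * 2^-1 ^+ n.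
    by rewrite mul1r; case: (sP n) => _ [_ _ _ + _]; apply.
  have Hcauchy := geom_cauchy step.
  move=> d d0; have d4 : 0 < d / 4 by rewrite divr_gt0.
  have [N NP] := geom_small d4; have NN := NP N (leqnn _).
  exists N => m n y Nm Nn; have := Hcauchy _ _ y Nm; have := Hcauchy _ _ y Nn.
  have := metric_triangle (H m y : R^o) (H N y) (H n y).
  rewrite (metric_sym (H m y : R^o) (H N y)); lra.
have hH d : 0 < d -> exists N, forall n y, (N <= n)%N -> `|h y - H n y| < d by exact: hP.
have Hconst n m y : (n <= m)%N -> T n y -> H m y = H n y.
  move=> nm Ty; rewrite -(subnKC nm); elim: (m - n)%N => [|k IH]; first by rewrite addn0.
  rewrite addnS -IH; case: (sP (n + k)%N) => _ [_ _ + _ _]; apply.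
  by apply: Tmono Ty; exact: leq_addr.
have hT n y : T n y -> h y = H n y.
  move=> Ty; apply/eqP; rewrite -subr_eq0 -normr_le0 leNgt; apply/negP => /hH[N NP].
  have := NP (maxn N n) y (leq_maxl _ _).
  by rewrite (Hconst n) ?leq_maxr // ltxx.
have gc : continuous g by exact: uniform_limit_cont Gc gP.
have hc : continuous h.
  by apply: (@uniform_limit_cont R D R^o H h) => // n; exact: stage_hc (st n).
have hg u : 0 <= u <= 1 -> h (g u) = f u.
  move=> u01; apply/eqP; rewrite -subr_eq0 -normr_le0 leNgt; apply/negP => d0.
  have d2 := divr_gt0 d0 (ltr0Sn R 1).
  move/cont_funP : hc => /(_ (g u) _ d2)[r r0 rP].
  have [N1 N1P] := gP r r0; have [N2 N2P] := hH _ d2.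
  pose n := maxn N1 N2.
  have := N1P n u (leq_maxl _ _); rewrite metric_sym => /rP.
  have := N2P n (G n u) (leq_maxr _ _).
  have -> : H n (G n u) = f u.
    by rewrite /G clamp_id //; exact: stage_factor (st n) _ u01.
  have := ler_normD (h (g u) - h (G n u)) (h (G n u) - f u).
  rewrite addrA subrK (distrC (h (g u)) (h (G n u))); lra.
have gonto y : exists2 u, 0 <= u <= 1 & g u = y.
  have cK : compact (g @` `[0, 1]%classic).
    by apply: continuous_compact; [exact: continuous_subspaceT|exact: segment_compact].
  have clK : closed (g @` `[0, 1]%classic) by apply: compact_closed => //; exact: metric_hausdorff.
  have [u + <-] : (g @` `[0, 1]%classic) y; last by rewrite /= in_itv; exists u.
  apply: clK => B /nbhs_distP[r r0 rB].
  have r2 := divr_gt0 r0 (ltr0Sn R 1).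
  have [N1 N1P] := Tdense _ r2; have [N2 N2P] := gP _ r2.
  pose n := maxn N1 N2.
  have [u u01 gu] := stage_onto (st n) (retr_in D_dendrite y (tT n)).
  exists (g u); split; first by exists u => //=; rewrite in_itv.
  apply: rB; have := N1P n y (leq_maxl _ _); have := N2P n u (leq_maxr _ _).
  rewrite /G clamp_id // gu; have := metric_triangle y (retr (T n) y) (g u); lra.
exists g, h; split => // U oU [y Uy].
(* an inner point of an arc inside U; its retraction onto a late tree is still
   in U and not an endpoint *)
have [b yb] : exists b, y <> b.
  by have [yb1|] := pselect (y = b1); [exists b2; rewrite yb1|exists b1].
have [phi [[pc pinj] p0 p1 pP]] := arc_param D_dendrite yb.
have [r r0 rU] : exists2 r, 0 < r & forall v, `|v| < r -> U (phi v).
  have : nbhs (phi 0) U by rewrite p0; exact: open_nbhs_nbhs.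
  move=> /nbhs_distP[r1 r10 r1U]; move/cont_pathP : (pc) => /(_ 0 r1 r10)[r r0 rP].
  by exists r => // v vr; apply: r1U; apply: rP; rewrite subr0.
have [v [v0 v1 vr]] : exists v, [/\ 0 < v, v < 1 & v < r].
  exists (Num.min (r / 2) (1 / 2)); rewrite lt_min !gt_min !divr_gt0 //; split => //.
    by apply/orP; right; lra.
  by apply/orP; left; lra.
have v01 : 0 <= v <= 1 by rewrite !ltW.
have Uv : U (phi v) by apply: rU; rewrite gtr0_norm.
have nend : ~ endpoint (phi v).
  move=> /(_ y b)[|/esym vy|vb]; first by apply/pP; exists v.
    by have := pinj 0 v; rewrite lexx ler01 p0 => /(_ isT v01 vy) v0'; rewrite -v0' ltxx in v0.
  by have := pinj v 1; rewrite lexx ler01 p1 => /(_ v01 isT vb) v1'; rewrite v1' ltxx in v1.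
have : nbhs (phi v) U by exact: open_nbhs_nbhs.
move=> /nbhs_distP[r1 r10 r1U].
have [n nP] := Tdense _ r10.
pose z := retr (T n) (phi v).
have Uz : U z by apply: r1U; exact: nP.
have Tz : T n z by exact: retr_in.
have zend : ~ endpoint z.
  move=> zend; have [a1 [a2 [Ta1 Ta2 a12]]] := stage_two (st n).
  have notv : z <> phi v by move=> zv; apply: nend; rewrite -zv.
  have [//|za1] := zend _ _ (retr_arc D_dendrite (y := phi v) (tT n) Ta1).
  have [//|za2] := zend _ _ (retr_arc D_dendrite (y := phi v) (tT n) Ta2).
  by apply: a12; rewrite -za1 -za2.
have [c [d [[c0 cd d1 fcd [u0 u0cd gu0]] ginj]]] := stage_crossing (st n) Tz zend.
have : nbhs z U by exact: open_nbhs_nbhs.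
move=> /nbhs_distP[r2 r20 r2U].
have [|r3 r30 r3P] := @factor_cont R R^o D f (s n).1.2 c d u0 f_cont (stage_gc (st n)) u0cd _ r2 r20.
  by move=> u ucd fu; apply: ginj.
have fu0 : f u0 = H n z.
  by rewrite -gu0 (stage_factor (st n)) //; exact: itv_sub u0cd.
have [c' [d' [cc' cd' dd' fcd' fnear]]] := shrink_crossing f_cont cd fcd r30.
exists (f c'), (f d'), (H n z); split => // w wcd.
have /andP[w1 w2] := wcd.
have [u ucd <-] := ivt f_cont (ltW cd') w1 w2.
have ucd' : c <= u <= d by exact: itv_sub ucd.
have u01 : 0 <= u <= 1 by exact: itv_sub ucd'.
exists ((s n).1.2 u).
  apply: r2U; rewrite -gu0; apply: r3P => //.
  by rewrite /mdist /= fu0; exact: fnear.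
rewrite (hT n); last exact: (stage_into (st n)).
exact: (stage_factor (st n)).
Qed.

End factorization.

(** Crookedness only involves the values of f on [0, 1]. *)
Lemma small_folds_clamp {R : realType} (f : R -> R) : small_folds f -> small_folds (f \o clamp).
Proof.
move=> ff lam l01; have [b [x [b0 x0 H]]] := ff lam l01.
exists b, x; split => // a a' a01 a'01 aa' c d c01 d01 /=.
have [c01' d01'] : 0 <= c <= 1 /\ 0 <= d <= 1 by split; exact/unit_intervalP.
rewrite !clamp_id // => fc fd.
have [c' [d' [b1 b2 h1 h2]]] := H a a' a01 a'01 aa' c d c01 d01 fc fd.
have btw (u v w : R) : 0 <= u <= 1 -> 0 <= v <= 1 -> between u v w -> 0 <= w <= 1.
  move=> /andP[u0 u1] /andP[v0 v1] /andP[w0 w1].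
  rewrite (le_trans _ w0) ?le_min ?u0 //= (le_trans w1) // ge_max u1 //.
have c'01 := btw _ _ _ c01' d01' b1; have d'01 := btw _ _ _ c'01 d01' b2.
by exists c', d'; rewrite !clamp_id.
Qed.

Theorem lemma4p5 (R : realType) (f : R -> R) (D : metricType R)
    (f_cont : {within unit_interval R, continuous f})
    (f_fun : set_fun (unit_interval R) (unit_interval R) f)
    (f_surj : set_surj (unit_interval R) (unit_interval R) f)
    (f_folds : small_folds f)
    (D_dendrite : is_dendrite D) :
  exists (g : R -> D) (h : D -> R),
    [/\ {within unit_interval R, continuous g}
          /\ set_surj (unit_interval R) [set: D] g,
        [/\ continuous h,
            set_fun [set: D] (unit_interval R) h
          & set_surj [set: D] (unit_interval R) h],
        forall t : R, unit_interval R t -> h (g t) = f t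
      & forall U : set D, open U -> U !=set0 ->
          rel_interior (unit_interval R) (h @` U) !=set0].
Proof.
have [||||g [h [gc hc gonto hg hopen]]] := @dendrite_factorization R D (f \o clamp) D_dendrite.
- exact: (@within_clamp_cont R R^o f f_cont).
- exact: small_folds_clamp.
- by move=> u u01 /=; apply/unit_intervalP; apply: f_fun; apply/unit_intervalP; exact: clamp_itv.
- move=> v /unit_intervalP/f_surj[u /unit_intervalP u01 <-].
  by exists u => //=; rewrite clamp_id.
have hgf t : unit_interval R t -> h (g t) = f t.
  by move=> /unit_intervalP t01; rewrite hg //= clamp_id.
have hunit y : unit_interval R (h y).
  by have [u /unit_intervalP u01 <-] := gonto y; rewrite hgf //; exact: f_fun.
exists g, h; split => //.
- split; first exact: continuous_subspaceT.
  by move=> y _; have [u /unit_intervalP u01 <-] := gonto y; exists u.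
- split => //.
  by move=> v /f_surj[u u01 <-]; exists (g u) => //; exact: hgf.
- move=> U oU U0; have [a [b [p [/andP[ap pb] abU]]]] := hopen U oU U0.
  have p01 : unit_interval R p.
    by have [|y _ <-] := abU p; [rewrite !ltW|exact: hunit].
  exists p; split => //.
  rewrite /interior; have [_|//] := nbhs_subspaceP (unit_interval R) p.
  rewrite /within /=; exists (Num.min (p - a) (b - p)); first by rewrite /= lt_min !subr_gt0 ap.
  move=> v; rewrite /ball /= lt_min !ltr_norml => /andP[/andP[_ h1] /andP[h2 _]] _.
  apply: abU; lra.
Qed.
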